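(* Let $t=2L_{20i-5}$ with $i\in\mathbb{Z}$. If the polynomial $$x^5+10x^3-5tx^2-15x-t^2+t-16$$ is irreducible over $\mathbb{Q}$, then its splitting field is an unramified cyclic extension of the quadratic extension $$\mathbb{Q}\left(\sqrt{-\sqrt{\frac{t^2+16}{500}}}\right)$$ of $\mathbb{Q}$. Moreover, the polynomial is irreducible over $\mathbb{Q}$ for all but a finite number of integers $t$, and hence this procedure generates an infinite family of such extensions.
   Context: $L_n$ ($n\in\mathbb{Z}$) are the Lucas numbers: $L_0=2$, $L_1=1$, $L_n=L_{n-1}+L_{n-2}$ for all integers $n$ (positive and negative). Equivalently $L_n=\tau^n+\bar\tau^n$, where $\tau,\bar\tau$ are the roots of $x^2-x-1$. *)

(* Defs.v *)
From HB Require Import structures.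
From mathcomp Require Import all_boot all_order all_algebra.
From mathcomp Require Import all_fingroup all_solvable all_field.
Set Implicit Arguments.
Unset Strict Implicit.
Unset Printing Implicit Defensive.
Import Order.TTheory GRing.Theory Num.Theory.
Local Open Scope ring_scope.

(* The pair (L_n, L_{n+1}) is obtained from (L_0, L_1) = (2, 1) by iterating
   the recurrence forwards for n >= 0 and backwards for n < 0. *)
Definition lucas (n : int) : int :=
  match n with
  | Posz k => (iter k (fun u : int * int => (u.2, u.1 + u.2)) (2, 1)).1
  | Negz k => (iter k.+1 (fun u : int * int => (u.2 - u.1, u.1)) (2, 1)).1
  end.

Lemma lucas0 : lucas 0 = 2. Proof. by []. Qed.

Lemma lucas1 : lucas 1 = 1. Proof. by []. Qed.

Lemma lucas_rec (n : int) : lucas n = lucas (n - 1) + lucas (n - 2).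
Proof.
case: n => [[|[|k]]|k] //.
- have -> : k.+2%:Z - 1 = k.+1%:Z by rewrite -[k.+2]addn1 PoszD addrK.
  have -> : k.+2%:Z - 2 = k%:Z by rewrite -[k.+2]addn2 PoszD addrK.
  by rewrite /lucas !iterS /= addrC.
- have -> : Negz k - 1 = Negz k.+1 by rewrite !NegzE -opprD -PoszD addn1.
  have -> : Negz k - 2 = Negz k.+2 by rewrite !NegzE -opprD -PoszD addn2.
  by rewrite /lucas !iterS /= [RHS]addrC subrK.
Qed.

Definition quintic (t : int) : {poly rat} :=
  'X^5 + 10%:P * 'X^3 - (5 * t%:~R)%:P * 'X^2 - 15%:P * 'X
  + (- t%:~R ^+ 2 + t%:~R - 16)%:P.

(* sqrtC is the nonnegative root on nonnegative arguments, so the inner radical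
   is the usual positive real one. *)
Definition nested_radical (t : int) : algC :=
  sqrtC (- sqrtC ((t%:~R ^+ 2 + 16) / 500)).

(* Subsets of a number field are Prop-valued predicates; ideals of the ring of
   integers are such subsets. *)
Section RingOfIntegers.

Variable L : fieldExtType rat.
Implicit Types (I J P : L -> Prop) (K : {subfield L}).

Definition ring_of_integers (x : L) : Prop := integralOver (intr : int -> L) x.

Definition is_ideal I : Prop :=
  [/\ forall x, I x -> ring_of_integers x,
      I 0,
      forall x y, I x -> I y -> I (x + y)
    & forall a x, ring_of_integers a -> I x -> I (a * x)].

Definition nonzero_prime_ideal P : Prop :=
  [/\ is_ideal P,
      exists2 x, P x & x != 0,
      ~ P 1
    & forall a b, ring_of_integers a -> ring_of_integers b ->
        P (a * b) -> P a \/ P b].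

Definition ideal_mul I J (x : L) : Prop :=
  exists2 s : seq (L * L),
    forall u, u \in s -> I u.1 /\ J u.2
  & x = \sum_(u <- s) u.1 * u.2.

Definition ideal_exp I (n : nat) : L -> Prop :=
  iter n (ideal_mul I) ring_of_integers.

(* p O_L, where p is the prime of K lying below P, i.e. p = P :&: O_K; elements
   of P are algebraic integers, so this is also P :&: K. *)
Definition below_ext K P : L -> Prop :=
  ideal_mul (fun x => P x /\ x \in K) ring_of_integers.

(* e is the exact exponent of P in p O_L, that is e = e(P | p). *)
Definition ramification_index K P (e : nat) : Prop :=
  (forall x, below_ext K P x -> ideal_exp P e x)
  /\ ~ (forall x, below_ext K P x -> ideal_exp P e.+1 x).

(* Residue fields are finite, so separability of residue extensions is
   automatic. *)
Definition unramified_finite K : Prop :=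
  forall P, nonzero_prime_ideal P -> ramification_index K P 1.

(* No real place of K becomes complex in L. Embeddings of a number field in the
   complex numbers take values in algC. *)
Definition unramified_infinite K : Prop :=
  forall sigma : {rmorphism L -> algC},
    (forall x, x \in K -> sigma x \is Num.real) ->
    forall x, sigma x \is Num.real.

Definition unramified K : Prop := unramified_finite K /\ unramified_infinite K.

End RingOfIntegers.

Definition unramified_cyclic (L : splittingFieldType rat) (K : {subfield L}) :
    Prop :=
  [/\ galois K {:L}, cyclic 'Gal({:L} / K) & unramified K].

Definition is_splitting_field (p : {poly rat}) (L : splittingFieldType rat) :
    Prop :=
  splittingFieldFor 1 (map_poly (in_alg L) p) {:L}.

(* Isomorphism of the extensions L / K and L' / K' (not fixing K, which may
   differ from K'). *)
Definition ext_isomorphic (L : splittingFieldType rat) (K : {subfield L})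
    (L' : splittingFieldType rat) (K' : {subfield L'}) : Prop :=
  exists2 phi : {rmorphism L -> L'},
    bijective phi & forall x, (x \in K) = (phi x \in K').

(* a generates a quadratic field over rat, is the nested radical attached to t
   (under the embedding iota of L), and L over rat(a) is unramified cyclic. *)
Definition quadratic_unramified_cyclic (t : int) (L : splittingFieldType rat)
    (iota : {rmorphism L -> algC}) (a : L) : Prop :=
  [/\ iota a = nested_radical t,
      \dim <<1; a>> = 2%N
    & unramified_cyclic <<1; a>>%AS].

(* Main.v *)
(* Write f_t for the quintic, s^2 = 5 (t^2 + 16), and let x be a root. Over Q(x, s)
   the quartic f_t / (X - x) splits into two explicit quadratics. For
   t = 2 L_{20i-5}, put (p, q) = (F_{10i-3}, F_{10i-2}) and F = p^2 + q^2; then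
   s = 10 F is rational and both discriminants are -F/5 times squares of Q(x).
   Hence the splitting field L has degree 5 over K = Q(a), a^2 = -F/5, which is the
   field of the nested radical.

   If a prime P of L were ramified over K, the group of order 5 would act trivially
   modulo P. But t = -22 mod 125 makes y = (x - 2)/5 integral, and the
   coefficients of its minimal polynomial show that its conjugates are not all
   congruent modulo P. The step from a nontrivial action to ramification index 1
   needs no finiteness of ideals: P^2 meets K locally in the square of P's trace
   on K, and in a quadratic field a prime is not contained in its square, by norms.

   For irreducibility, a quadratic factor of f_t would make another root rational
   over a field of degree at most 4, where no root of a cubic factor can live; so
   reducible f_t has an integer root. The curve f_t(x) = 0 is birational to the elliptic
   curve y^2 + xy + y = x^3 - x - 2 of conductor 50 and rank 0, whose integral points
   are found by 3-descent through Z[om]; this leaves t = 3 and t = -22.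

   Finally, along indices 5 m with pairwise coprime m the numbers F_{5m}/5 are pairwise
   coprime, and they are 2 mod 3, hence not squares, so the fields K are distinct. *)
Require Import Defs.
From HB Require Import structures.
From mathcomp Require Import all_boot all_order all_algebra.
From mathcomp Require Import all_fingroup all_solvable all_field.
From mathcomp Require Import zify ring.
From Stdlib Require Import Classical ClassicalEpsilon.
Set Implicit Arguments.
Unset Strict Implicit.
Unset Printing Implicit Defensive.
Import Order.TTheory GRing.Theory Num.Theory.
Local Open Scope ring_scope.

(** * Coprime factors of cubes, in the integers and in Z[om] *)

(** At the degenerate value t = -22 the roots of f_t are 2, -3 (twice), 2 + 5 i and 2 - 5 i, all
    congruent to 2 modulo 5. For t = -22 mod 125 the polynomial f_t(5 Y + 2) is still divisible by
    5^5, which is where y comes from. The index 20 i - 5 secures this congruence and, 10 i - 3 being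
    odd, the sign in q^2 - p q - p^2 = -1. Ideals are bare predicates, with no factorization or
    localization at hand, so being a unit at P is expressed by multipliers outside P ([de], [q],
    [m]). A 3-descent is possible because in X = x - 2 the elliptic curve takes the form Y (Y + 5 X
    + 5) = X^3, on which (0, 0) has order 3. One of the two isogenies needs only cubes of integers,
    its dual needs cubes in Z[om]. *)

Section CoprimeCube.

Variables (R : idomainType) (S : R -> Prop).
Hypotheses (SD : forall x y, S x -> S y -> S (x + y))
           (SM : forall x y, S x -> S y -> S (x * y)).
Hypothesis bezout : forall a b, S a -> S b ->
  exists d, exists u, exists v, exists a', exists b',
  [/\ [/\ S d, S u, S v, S a' & S b'], a = d * a', b = d * b'
    & d = u * a + v * b].

(* With d = gcd(a, c), a = d a' and c = d c', coprimality gives a' ~ d^2. *)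
Lemma coprime_mul_cube a b c x y :
    S a -> S b -> S c -> S x -> S y ->
    a != 0 -> x * a + y * b = 1 -> a * b = c ^+ 3 ->
  exists e, exists e', exists d,
    [/\ S e, S e', S d, e * e' = 1 & a = e * d ^+ 3].
Proof.
move=> Sa Sb Sc Sx Sy a0 xyab abc.
have [d [u [v [a' [c' [[Sd Su Sv Sa' Sc'] Da Dc Dd]]]]]] := bezout Sa Sc.
have d0 : d != 0 by apply: contraNneq a0 => d0; rewrite Da d0 mul0r.
have uv1 : u * a' + v * c' = 1.
  by apply: (mulfI d0); rewrite mulr1 [RHS]Dd [in RHS]Da [in RHS]Dc; ring.
have a'b : a' * b = d ^+ 2 * c' ^+ 3.
  by apply: (mulfI d0); rewrite mulrA -Da abc Dc; ring.
(* [k] comes from expanding d^2 (u a' + v c')^3 and [l] from a' (x a + y b)^2, so that a' and d^2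
   divide each other. Both avoid subtraction and numerals, since [S] is only closed under sums and
   products. *)
pose k := d * d * (u * (u * a' * (u * a') + u * a' * (v * c') + u * a' * (v * c')
   + u * a' * (v * c') + v * c' * (v * c') + v * c' * (v * c') + v * c' * (v * c')))
  + v * v * v * b.
pose l := x * a' * (x * a') * a' + c' * c' * c' * (x * y * (d * a')
   + x * y * (d * a') + y * y * b).
have Sk : S k by rewrite /k; do ![assumption | apply: SD | apply: SM].
have Sl : S l by rewrite /l; do ![assumption | apply: SD | apply: SM].
have dk : d ^+ 2 = a' * k.
  transitivity (d ^+ 2 * (u * a' + v * c') ^+ 3); first by rewrite uv1; ring.
  transitivity (d ^+ 2 * ((u * a' + v * c') ^+ 3 - (v * c') ^+ 3)
    + v ^+ 3 * (d ^+ 2 * c' ^+ 3)); first by ring.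
  by rewrite -a'b /k; ring.
have al : a' = d ^+ 2 * l.
  transitivity (a' * (x * a + y * b) ^+ 2); first by rewrite xyab; ring.
  transitivity (d ^+ 2 * (x * a') ^+ 2 * a' + a' * b * (2 * x * y * d * a' + y ^+ 2 * b)).
    by rewrite Da; ring.
  by rewrite a'b /l; ring.
exists l; exists k; exists d; split=> //; last by rewrite Da {1}al; ring.
have d20 : d ^+ 2 != 0 by rewrite expf_neq0.
by apply: (mulfI d20); rewrite mulr1 mulrA -al -dk.
Qed.

End CoprimeCube.

Lemma int_bezout (a b : int) : exists d, exists u, exists v, exists a', exists b',
  [/\ [/\ True, True, True, True & True], a = d * a', b = d * b'
    & d = u * a + v * b].
Proof.
have [u [v uv]] := Bezoutz a b.
exists (gcdz a b), u, v, (a %/ gcdz a b)%Z, (b %/ gcdz a b)%Z; split=> //.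
- by rewrite mulrC divzK ?dvdz_gcdl.
- by rewrite mulrC divzK ?dvdz_gcdr.
Qed.

Lemma int_coprime_cube (a b c : int) :
  coprimez a b -> a * b = c ^+ 3 -> exists d, a = d ^+ 3.
Proof.
move=> cop abc; have [-> | a0] := eqVneq a 0; first by exists 0; rewrite expr0n.
have /coprimezP [[u v] /= uv] := cop.
have [] := @coprime_mul_cube int (fun=> True) _ _ _ a b c u v => //.
  by move=> *; apply: int_bezout.
move=> e [e' [d [_ _ _ + ->]]].
rewrite mulrC => /intUnitRing.unitzPl /orP[] /eqP->.
  by exists d; rewrite mul1r.
by exists (- d); ring.
Qed.

(* a + b w, for w a primitive cube root of unity. *)
Definition eis (w : algC) (a b : int) : algC := a%:~R + b%:~R * w.
Definition eis_norm (a b : int) : int := a ^+ 2 - a * b + b ^+ 2.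

Lemma cube_root_unity : exists w : algC, w ^+ 2 + w + 1 = 0.
Proof.
have [w pw] := C_prim_root_exists (isT : (0 < 3)%N).
have w1 : w - 1 != 0.
  rewrite subr_eq0; apply: contraTneq pw => ->.
  by apply/negP => /prim_order_dvd/(_ 1%N); rewrite expr1 eqxx.
exists w; apply: (mulfI w1); rewrite mulr0.
by have := prim_expr_order pw => w3; transitivity (w ^+ 3 - 1); [ring | rewrite w3 subrr].
Qed.

Section Eisenstein.

Variable w : algC.
Hypothesis w2 : w ^+ 2 + w + 1 = 0.

Let wE : w ^+ 2 = - w - 1.
Proof. by apply/eqP; rewrite -subr_eq0; apply/eqP; rewrite -w2; ring. Qed.

Lemma eisM a b c d : eis w a b * eis w c d = eis w (a * c - b * d) (a * d + b * c - b * d).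
Proof.
rewrite /eis !(intrD, intrB, intrM, rmorphN) /=.
transitivity (a%:~R * c%:~R + (a%:~R * d%:~R + b%:~R * c%:~R) * w + b%:~R * d%:~R * w ^+ 2); first by ring.
by rewrite wE; ring.
Qed.

Lemma eisB a b c d : eis w a b - eis w c d = eis w (a - c) (b - d).
Proof. by rewrite /eis !(intrD, intrB, rmorphN) /=; ring. Qed.

Lemma eisD a b c d : eis w a b + eis w c d = eis w (a + c) (b + d).
Proof. by rewrite /eis !(intrD, intrB, rmorphN) /=; ring. Qed.

(** The other primitive cube root of unity is - 1 - w, so the conjugate of a + b w is (a - b) - b
    w. *)
Lemma eis_normE a b : (eis_norm a b)%:~R = eis w a b * eis w (a - b) (- b).
Proof. by rewrite eisM /eis /eis_norm; rewrite (_ : a * - b + _ - _ = 0) ?mul0r ?addr0; [congr _%:~R|]; ring. Qed.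

Lemma eis_norm_ge0 a b : 0 <= eis_norm a b.
Proof. rewrite /eis_norm; nia. Qed.

Lemma eis_norm_eq0 a b : eis_norm a b = 0 -> a = 0 /\ b = 0.
Proof. rewrite /eis_norm => h; split; nia. Qed.

Lemma eis_inj a b c d : eis w a b = eis w c d -> a = c /\ b = d.
Proof.
move=> /eqP; rewrite -subr_eq0 eisB => /eqP e.
have : (eis_norm (a - c) (b - d))%:~R = 0 :> algC by rewrite eis_normE e mul0r.
by move=> /eqP; rewrite intr_eq0 => /eqP/eis_norm_eq0 []; split; lia.
Qed.

Lemma eis_normM a b c d :
  eis_norm (a * c - b * d) (a * d + b * c - b * d) = eis_norm a b * eis_norm c d.
Proof. by rewrite /eis_norm; ring. Qed.

Lemma centered_div (A n : int) : 0 < n -> exists q, `|2 * (A - q * n)| <= n.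
Proof.
move=> n0; exists ((2 * A + n) %/ (2 * n))%Z.
have n2 : 2 * n != 0 by lia.
have := divz_eq (2 * A + n) (2 * n); have := modz_ge0 (2 * A + n) n2.
have := ltz_mod (2 * A + n) n2.
move: (_ %/ _)%Z (_ %% _)%Z => q r; nia.
Qed.

(** Multiply by the conjugate of c + d w, which gives [A] + [B] w, and round [A] / n and [B] / n to
    nearest integers. Errors of at most 1/2 in both coordinates leave a remainder of norm at most 3
    n / 4. *)
Lemma eis_div (a b c d : int) : eis_norm c d != 0 -> exists q1, exists q2,
  eis_norm (a - (c * q1 - d * q2)) (b - (c * q2 + d * q1 - d * q2)) < eis_norm c d.
Proof.
move=> n0; have n_gt0 : 0 < eis_norm c d by rewrite lt0r n0 eis_norm_ge0.
set n := eis_norm c d in n0 n_gt0 *.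
pose A := a * (c - d) + b * d; pose B := b * c - a * d.
have [q1 h1] := centered_div A n_gt0; have [q2 h2] := centered_div B n_gt0.
exists q1, q2; rewrite -(ltr_pM2r n_gt0).
suff -> : eis_norm (a - (c * q1 - d * q2)) (b - (c * q2 + d * q1 - d * q2)) * n
  = eis_norm (A - q1 * n) (B - q2 * n).
  move: (A - q1 * n) (B - q2 * n) h1 h2 => X Y h1 h2; rewrite /eis_norm.
  have sq (Z : int) : `|2 * Z| <= n -> 4 * (Z * Z) <= n * n.
    rewrite ler_norml => /andP[zl zr].
    have : 0 <= (n - 2 * Z) * (n + 2 * Z) by apply: mulr_ge0; lia.
    by rewrite (_ : _ * _ = n * n - 4 * (Z * Z)); [lia | ring].
  have := sq _ h1; have := sq _ h2.
  have : 0 <= (X + Y) * (X + Y) by rewrite -expr2 sqr_ge0.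
  have : 0 < n * n by rewrite mulr_gt0.
  have : 2 * eis_norm X Y = 3 * (X * X + Y * Y) - (X + Y) * (X + Y).
    by rewrite /eis_norm; ring.
  lia.
by rewrite /n /eis_norm /A /B; ring.
Qed.

Let S (z : algC) := exists a b : int, z = eis w a b.

Lemma eis_bezout (a b : algC) : S a -> S b ->
  exists d, exists u, exists v, exists a', exists b',
  [/\ [/\ S d, S u, S v, S a' & S b'], a = d * a', b = d * b'
    & d = u * a + v * b].
Proof.
move=> Sa [c [d Db]]; have [n] := ubnP `|eis_norm c d|%N.
elim: n => // n IHn in a b c d Sa Db *.
rewrite ltnS => len.
have S0 : S 0 by exists 0, 0; rewrite /eis mul0r addr0.
have S1 : S 1 by exists 1, 0; rewrite /eis mul0r addr0.
have SM x y : S x -> S y -> S (x * y).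
  by move=> [x1 [x2 ->]] [y1 [y2 ->]]; rewrite eisM; eexists; eexists.
have SB x y : S x -> S y -> S (x - y).
  by move=> [x1 [x2 ->]] [y1 [y2 ->]]; rewrite eisB; eexists; eexists.
have SD x y : S x -> S y -> S (x + y).
  by move=> [x1 [x2 ->]] [y1 [y2 ->]]; rewrite eisD; eexists; eexists.
have Sb : S b by rewrite Db; exists c, d.
have [n0 | n0] := eqVneq (eis_norm c d) 0.
  have [c0 d0] := eis_norm_eq0 n0.
  have b0 : b = 0 by rewrite Db /eis c0 d0 mul0r addr0.
  exists a, 1, 0, 1, 0; split=> //; rewrite ?b0; ring.
case: Sa => a1 [a2 Da]; have [q1 [q2 lt_n]] := eis_div a1 a2 n0.
set r1 := a1 - _ in lt_n; set r2 := a2 - _ in lt_n.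
have Dr : a = eis w r1 r2 + b * eis w q1 q2.
  by rewrite Db eisM eisD Da; congr eis; rewrite /r1 /r2; ring.
have [|g [u [v [a' [b' [[Sg Su Sv Sa' Sb'] Da' Db' Dg]]]]]] :=
    IHn b (eis w r1 r2) r1 r2 Sb erefl.
  by have := eis_norm_ge0 r1 r2; have := eis_norm_ge0 c d; lia.
have Sq : S (eis w q1 q2) by exists q1, q2.
exists g, v, (u - v * eis w q1 q2), (b' + a' * eis w q1 q2), a'; split=> //.
- by split=> //; [apply: SB | apply: SD] => //; apply: SM.
- by rewrite Dr Db' {1}Da'; ring.
- by rewrite Dg Dr; ring.
Qed.

(** Coprimality of trace and norm makes z = a + b w coprime to its conjugate, so z is a unit times a
    cube. Every cube in Z[w] has its w-coordinate divisible by 3, so 3 | b leaves only the units 1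
    and -1, which are cubes themselves. *)
Lemma eis_cube a b k c :
    (3 %| b)%Z -> ~~ (3 %| eis_norm a b)%Z ->
    coprimez (2 * a - b) (eis_norm a b) -> coprimez (eis_norm a b) k ->
    eis_norm a b * k = c ^+ 3 ->
  exists x y : int, a = x ^+ 3 + y ^+ 3 - 3 * (x * y ^+ 2) /\ b = 3 * (x ^+ 2 * y - x * y ^+ 2).
Proof.
move=> b3 n3 /coprimezP[[u v] /= uv] /coprimezP[[u' v'] /= uv'] nk.
have S0 : S 0 by exists 0, 0; rewrite /eis mul0r addr0.
have SI m : S m%:~R by exists m, 0; rewrite /eis mul0r addr0.
have SM x y : S x -> S y -> S (x * y).
  by move=> [x1 [x2 ->]] [y1 [y2 ->]]; rewrite eisM; eexists; eexists.
have SD x y : S x -> S y -> S (x + y).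
  by move=> [x1 [x2 ->]] [y1 [y2 ->]]; rewrite eisD; eexists; eexists.
pose z := eis w a b; pose z' := eis w (a - b) (- b).
have Sz : S z by exists a, b.
have Sz' : S z' by exists (a - b), (- b).
have zz' : z * z' = (eis_norm a b)%:~R by rewrite eis_normE.
have zDz' : z + z' = (2 * a - b)%:~R.
  by rewrite /z /z' eisD /eis (_ : b - b = 0) ?mul0r ?addr0; [congr _%:~R|]; ring.
have z0 : z != 0.
  apply: contraNneq n3 => z0; have : (eis_norm a b)%:~R = 0 :> algC.
    by rewrite -zz' z0 mul0r.
  by move=> /eqP; rewrite intr_eq0 => /eqP->; rewrite dvdz0.
have e1 : u%:~R * (z + z') + v%:~R * (z * z') = 1.
  by rewrite zz' zDz' -!intrM -intrD uv.
have e2 : u'%:~R * (z * z') + v'%:~R * k%:~R = 1.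
  by rewrite zz' -!intrM -intrD uv'.
have Sb : S (z' * k%:~R) := SM _ _ Sz' (SI _).
have Sx : S (u%:~R + v%:~R * z' + u%:~R * z' * (u'%:~R * z')).
  by apply: (SD _ _ (SD _ _ (SI _) (SM _ _ (SI _) Sz')));
    apply: (SM _ _ (SM _ _ (SI _) Sz') (SM _ _ (SI _) Sz')).
have Sy : S (u%:~R * v'%:~R) := SM _ _ (SI _) (SI _).
(* Bezout relation for z and z' k: in [e1] the term u z' is multiplied by the left-hand side of
   [e2]. *)
have e12 : (u%:~R + v%:~R * z' + u%:~R * z' * (u'%:~R * z')) * z
    + u%:~R * v'%:~R * (z' * k%:~R) = 1.
  transitivity (u%:~R * z + v%:~R * (z * z')
    + u%:~R * z' * (u'%:~R * (z * z') + v'%:~R * k%:~R)); first by ring.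
  by rewrite e2 -[RHS]e1; ring.
have e3 : z * (z' * k%:~R) = c%:~R ^+ 3 by rewrite mulrA zz' -intrM nk rmorphXn.
have [e [e' [d [[e1' [e2' De]] [e3' [e4' De']] [x [y Dd]] ee' Dz]]]] :=
  coprime_mul_cube SD SM eis_bezout Sz Sb (SI c) Sx Sy z0 e12 e3.
have ne : eis_norm e1' e2' * eis_norm e3' e4' = 1.
  have : eis w (e1' * e3' - e2' * e4') (e1' * e4' + e2' * e3' - e2' * e4') = eis w 1 0.
    by rewrite -eisM -De -De' ee' /eis mul0r addr0.
  by move=> /eis_inj[ea eb]; rewrite -eis_normM ea eb.
have {}ne : eis_norm e1' e2' = 1.
  have := eis_norm_ge0 e1' e2'; have := eis_norm_ge0 e3' e4'; move: ne.
  move: (eis_norm _ _) (eis_norm _ _) => [[|[|m]]|m] [[|[|m']]|m'] //; nia.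
pose X := x ^+ 3 + y ^+ 3 - 3 * (x * y ^+ 2); pose Y := 3 * (x ^+ 2 * y - x * y ^+ 2).
have d3 : d ^+ 3 = eis w X Y.
  by rewrite Dd !exprS expr0 mulr1 !eisM; congr eis; rewrite /X /Y; ring.
have [Da Db] : a = e1' * X - e2' * Y /\ b = e1' * Y + e2' * X - e2' * Y.
  by apply: eis_inj; rewrite -eisM -De -d3.
have Y3 : (3 %| Y)%Z by rewrite /Y dvdz_mulr.
(* Since 3 divides b and Y, the formula for b leaves 3 | e2' X. If 3 | X, then 3 divides z and hence
   its norm, which is excluded. *)
have /orP[e23 | X3] : (3 %| e2')%Z || (3 %| X)%Z.
- have : (3 %| e2' * X)%Z by move: b3 Y3; rewrite Db; lia.
  by rewrite !dvdzE abszM Euclid_dvdM.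
- have [e20 e1s] : e2' = 0 /\ (e1' = 1 \/ e1' = -1).
    case/dvdzP: e23 => q e2q.
    have e4 : (2 * e1' - e2') ^+ 2 + 27 * (q * q) = 4.
      by transitivity (4 * eis_norm e1' e2'); [rewrite /eis_norm e2q; ring | rewrite ne].
    have q0 : q = 0.
      apply/eqP; apply: contraT => q0; have := sqr_ge0 (2 * e1' - e2').
      have : 0 < q * q by rewrite -expr2 exprn_even_gt0.
      by move: e4; move: (_ ^+ 2) (q * q); lia.
    move: e2q ne; rewrite q0 mul0r => ->; rewrite /eis_norm mulr0 subr0 addr0.
    by move=> /eqP; rewrite sqrf_eq1 => /orP[] /eqP; auto.
  case: e1s => e1s; [exists x, y | exists (- x), (- y)];
    by rewrite Da Db e20 e1s /X /Y; split; ring.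
- case/negP: n3; case/dvdzP: X3 => X' EX; case/dvdzP: Y3 => Y' EY; rewrite /eis_norm.
  by rewrite Da Db EX EY; apply/dvdzP; exists ((e1' * X' - e2' * Y') * (e1' * (X' * 3) - e2' * (Y' * 3))
    - (e1' * X' - e2' * Y') * (e1' * (Y' * 3) + e2' * (X' * 3) - e2' * (Y' * 3))
    + (e1' * Y' + e2' * X' - e2' * Y') * (e1' * (Y' * 3) + e2' * (X' * 3) - e2' * (Y' * 3))); ring.
Qed.

End Eisenstein.

(** * Integral points on the curve of conductor 50 *)

Lemma prime_dvdzM (p : nat) (a b : int) : prime p ->
  (p %| a * b)%Z = (p %| a)%Z || (p %| b)%Z.
Proof. by move=> pp; rewrite !dvdzE abszM Euclid_dvdM. Qed.

Lemma prime_dvdzX (p : nat) (a : int) n : prime p -> (p %| a ^+ n.+1)%Z = (p %| a)%Z.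
Proof. by move=> pp; rewrite !dvdzE abszX Euclid_dvdX // andbT. Qed.

Lemma coprimez_prime (a b : int) :
  (forall p : nat, prime p -> (p %| a)%Z -> (p %| b)%Z -> False) -> coprimez a b.
Proof.
move=> h; rewrite /coprimez /gcdz; apply/negPn/negP => g1.
have [g0 | g_gt0] := posnP (gcdn `|a| `|b|).
  by apply: (h 2) => //; rewrite dvdzE; [move: (dvdn_gcdl `|a| `|b|) | move: (dvdn_gcdr `|a| `|b|)];
   rewrite g0 dvd0n => /eqP->; rewrite dvdn0.
have pp : prime (pdiv (gcdn `|a| `|b|)) by apply: pdiv_prime; lia.
have := pdiv_dvd (gcdn `|a| `|b|); rewrite dvdn_gcd => /andP[da db].
by apply: (h _ pp); rewrite dvdzE.
Qed.

Lemma coprimez_primeP (a b : int) (p : nat) :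
  coprimez a b -> prime p -> (p %| a)%Z -> (p %| b)%Z -> False.
Proof.
rewrite /coprimez /gcdz !dvdzE => /eqP[g1] pp pa pb.
by have := dvdn_gcd p `|a| `|b|; rewrite g1 dvdn1 pa pb => /eqP p1; rewrite p1 in pp.
Qed.

Lemma expz3_inj (a b : int) : a ^+ 3 = b ^+ 3 -> a = b.
Proof.
move=> e; apply/eqP; rewrite -subr_eq0; apply/negPn/negP => ab.
have : (a - b) * eis_norm a (- b) = 0.
  by transitivity (a ^+ 3 - b ^+ 3); [rewrite /eis_norm; ring | rewrite e subrr].
move=> /eqP; rewrite mulf_eq0 (negPf ab) /= => /eqP /eis_norm_eq0[a0 b0].
by move: ab; rewrite a0; lia.
Qed.

(** Common end of both cases of the descent. Every prime dividing the norm divides W, so the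
    coprimality conditions of [eis_cube] need checking only at primes dividing W. *)
Lemma eis_cube_factor (a b k W : int) :
    (3 %| b)%Z -> ~~ (3 %| eis_norm a b)%Z -> eis_norm a b * k = (- W) ^+ 3 ->
    (forall p : nat, prime p -> (p %| W)%Z -> (p %| 2 * a - b)%Z ->
       (p %| eis_norm a b)%Z -> False) ->
    (forall p : nat, prime p -> (p %| W)%Z -> (p %| k)%Z -> (p %| eis_norm a b)%Z ->
       (p %| 2 * a - b)%Z) ->
  exists x, exists y, exists c : int, [/\ a = x ^+ 3 + y ^+ 3 - 3 * (x * y ^+ 2),
    b = 3 * (x ^+ 2 * y - x * y ^+ 2), k = c ^+ 3 & W = - c * eis_norm x y].
Proof.
move=> b3 N3 Nk TN kT; have [om om2] := cube_root_unity.
have NW (p : nat) : prime p -> (p %| eis_norm a b)%Z -> (p %| W)%Z.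
  move=> pp pN; have : (p %| (- W) ^+ 3)%Z by rewrite -Nk dvdz_mulr.
  by rewrite prime_dvdzX // rpredN.
have cTN : coprimez (2 * a - b) (eis_norm a b).
  by apply: coprimez_prime => p pp pT pN; apply: (TN p) => //; apply: NW.
have cNk : coprimez (eis_norm a b) k.
  apply: coprimez_prime => p pp pN pk; have pW := NW p pp pN.
  by apply: (TN p) => //; apply: kT.
have [x [y [Da Db]]] := eis_cube om2 b3 N3 cTN cNk Nk.
have ck : coprimez k (eis_norm a b) by rewrite coprimez_sym.
have kN : k * eis_norm a b = (- W) ^+ 3 by rewrite mulrC.
have [c Dk] := int_coprime_cube ck kN.
exists x, y, c; split=> //; apply: oppr_inj; apply: expz3_inj; rewrite -Nk Dk.
by rewrite Da Db /eis_norm; ring.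
Qed.

(** * One descent step on u^3 + v^3 + 5 w^3 = 5 u v w *)

Section Step.

Variables u v w : int.
Hypotheses (uv : coprimez u v) (uw : coprimez u w) (vw : coprimez v w)
  (w0 : w != 0) (E : u ^+ 3 + v ^+ 3 + 5 * w ^+ 3 = 5 * (u * v * w)).

Let s : int := u + v.
Let d : int := u - v.

Let step_even : (2 %| 5 * w + 3 * s)%Z.
Proof.
have huv := coprimez_primeP (p := 2) uv isT; have huw := coprimez_primeP (p := 2) uw isT.
have hvw := coprimez_primeP (p := 2) vw isT; apply/negPn/negP; rewrite /s => h.
(* If 5 w + 3 s is odd, coprimality forces u, v, w all odd, and then the two sides of the equation
   differ by 2 modulo 4. *)
have [a Da] : exists a, u = 2 * a + 1.
  exists (u %/ 2)%Z; move: huv huw hvw h; lia.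
have [b Db] : exists b, v = 2 * b + 1.
  exists (v %/ 2)%Z; move: huv huw hvw h; lia.
have [c Dc] : exists c, w = 2 * c + 1.
  exists (w %/ 2)%Z; move: huv huw hvw h; lia.
move: E; rewrite Da Db Dc => /eqP; rewrite -subr_eq0 => /eqP E'.
have : 4 * (2 * (a ^+ 3 + b ^+ 3 + 5 * c ^+ 3) + 3 * (a ^+ 2 + b ^+ 2 + 5 * c ^+ 2)
   - 5 * (2 * (a * b * c) + a * b + a * c + b * c) - a - b + 5 * c) = - 2 :> int.
  by apply/eqP; rewrite -subr_eq0 -[X in _ == X]E'; apply/eqP; ring.
have n42 (X : int) : 4 * X <> - 2 by clear; lia.
by move=> /n42.
Qed.

(** 5 divides s N(u, v) by the equation. It is inert in Z[om], so it divides N(u, v) only if it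
    divides both u and v. *)
Let step5 : (5 %| s)%Z.
Proof.
have h : (5 %| u ^+ 3 + v ^+ 3)%Z.
  by apply/dvdzP; exists (u * v * w - w ^+ 3); rewrite -[u ^+ 3 + _](addrK (5 * w ^+ 3)) E; ring.
have {h} : (5 %| s * eis_norm u v)%Z by rewrite (_ : _ * _ = u ^+ 3 + v ^+ 3) // /s /eis_norm; ring.
rewrite prime_dvdzM // => /orP[//|n5].
have Du := divz_eq u 5; have Dv := divz_eq v 5.
have ru := modz_ge0 u (isT : 5 != 0 :> int); have rv := modz_ge0 v (isT : 5 != 0 :> int).
have ru' := ltz_mod u (isT : 5 != 0 :> int); have rv' := ltz_mod v (isT : 5 != 0 :> int).
have : (5 %| eis_norm (u %% 5)%Z (v %% 5)%Z)%Z.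
  have key qu qv a b : eis_norm (qu * 5 + a) (qv * 5 + b) = 5 * (qu * (qu * 5) + 2 * (qu * a)
      - (qu * b + a * qv + 5 * (qu * qv)) + qv * (qv * 5) + 2 * (qv * b)) + eis_norm a b.
    by rewrite /eis_norm; ring.
  by move: n5; rewrite [X in eis_norm X]Du [X in eis_norm _ X]Dv key rpredDl // dvdz_mulr.
have huv := coprimez_primeP (p := 5) uv isT.
move: Du Dv ru rv ru' rv' huv; rewrite /s /eis_norm; clear.
case: (u %% 5)%Z => [[|[|[|[|[|?]]]]]|] //; case: (v %% 5)%Z => [[|[|[|[|[|?]]]]]|] //=; lia.
Qed.

(** Adding the first and third equations eliminates s: 15 c N(x, y) + 10 c^3 is a binary cubic form
    in x, y. The relation says that three linear forms, congruent modulo 3, have product 135 c^3.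
    Their thirds are P, Q, R. *)
Lemma step_finish c x y : 5 * w + 3 * s = - 10 * c ^+ 3 -> w = c * eis_norm x y ->
    10 * w - 3 * s = 2 * x ^+ 3 - 3 * (x ^+ 2 * y) - 3 * (x * y ^+ 2) + 2 * y ^+ 3 ->
  exists P, exists Q, exists R, exists c : int,
    [/\ P + Q + R = 5 * c, P * Q * R = 5 * c ^+ 3, (c %| w)%Z & c != 0].
Proof.
move=> e1 Dw e2; have c0 : c != 0 by apply: contraNneq w0 => c0; rewrite Dw c0 mul0r.
have e : (2 * x - y + 5 * c) * (- x - y + 5 * c) * (- x + 2 * y + 5 * c) = 135 * c ^+ 3.
  have e3 : 10 * c ^+ 3 + 15 * c * eis_norm x y
      - (2 * x ^+ 3 - 3 * (x ^+ 2 * y) - 3 * (x * y ^+ 2) + 2 * y ^+ 3) = 0.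
    by rewrite -e2 -mulrA -Dw; move: (c ^+ 3) e1; clear; lia.
  apply/eqP; rewrite -subr_eq0 -oppr_eq0 -[X in _ == X]e3 /eis_norm; apply/eqP; ring.
have /dvdzP[Q DQ] : (3 %| - x - y + 5 * c)%Z.
  have : (3 %| 135 * c ^+ 3)%Z by rewrite dvdz_mulr.
  by rewrite -e !prime_dvdzM //; clear; lia.
exists (Q + x), Q, (Q + y), c; split=> //; first by move: DQ; clear; lia.
  apply: (@mulfI _ 27) => //; transitivity (135 * c ^+ 3); last by ring.
  have -> : 135 * c ^+ 3 = (Q * 3 + 3 * x) * (Q * 3) * (Q * 3 + 3 * y).
    by rewrite -e -DQ; ring.
  by ring.
by rewrite Dw dvdz_mulr.
Qed.

Let coprime_sd (p : nat) : prime p -> (p %| w)%Z -> (p %| s)%Z -> (p %| d)%Z ->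
  (p == 2)%N.
Proof.
move=> pp pw ps pd; apply: contraT => p2.
have : (p %| 2 * u)%Z by have -> : 2 * u = s + d; [rewrite /s /d; ring | rewrite rpredD].
rewrite prime_dvdzM // => /orP[|pu]; first by rewrite dvdzE dvdn_prime2 // (negPf p2).
by case: (coprimez_primeP uw pp).
Qed.

(* The element z1 = 5w + 3(om u + om^2 v) of Z[om] and z0 = 5w + 3(u + v) satisfy
   z0 N(z1) = -10 w^3. *)
Lemma step_3ndvd : ~~ (3 %| w)%Z ->
  exists x, exists y, exists c,
  [/\ 5 * w + 3 * s = - 10 * c ^+ 3, w = c * eis_norm x y &
    10 * w - 3 * s = 2 * x ^+ 3 - 3 * (x ^+ 2 * y) - 3 * (x * y ^+ 2) + 2 * y ^+ 3].
Proof.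
move=> w3.
have /dvdzP[k Dk] : (10 %| 5 * w + 3 * s)%Z by move: step_even step5; clear; lia.
pose a : int := 5 * w - 3 * v; pose b : int := 3 * d.
have Nk : eis_norm a b * k = (- w) ^+ 3.
  apply: (@mulfI _ 10) => //; apply/eqP; rewrite -subr_eq0; apply/eqP.
  transitivity ((5 * w + 3 * s) * eis_norm a b + 10 * w ^+ 3); first by rewrite Dk; ring.
  (* X^3 + Y^3 + Z^3 - 3 X Y Z = (X + Y + Z) N(X + om Y + om^2 Z) at X = 5 w, Y = 3 u, Z = 3 v. The
     term - 10 w^3 is what remains of 125 w^3 after taking out 135 w^3. *)
  transitivity (27 * (u ^+ 3 + v ^+ 3 + 5 * w ^+ 3 - 5 * (u * v * w))).
    by rewrite /a /b /eis_norm /s /d; ring.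
  by rewrite E subrr mulr0.
have DT : 2 * a - b = 10 * w - 3 * s by rewrite /a /b /s /d; ring.
have N4 : 4 * eis_norm a b = (2 * a - b) ^+ 2 + 3 * b ^+ 2 by rewrite /eis_norm; ring.
have p3W (p : nat) : prime p -> (p %| w)%Z -> (p %| 3)%Z = false.
  move=> pp pw; rewrite dvdzE dvdn_prime2 //; apply: contraNF w3 => /eqP /= p3.
  by rewrite p3 in pw.
have psW (p : nat) : prime p -> (p %| w)%Z -> (p %| 3 * s)%Z -> (p %| s)%Z.
  by move=> pp pw; rewrite prime_dvdzM // p3W.
have [|||||x [y [c [Da Db Dk' Dw]]]] := @eis_cube_factor a b k w.
- by rewrite /b dvdz_mulr.
- apply: contra w3 => N3; rewrite -rpredN -(prime_dvdzX _ 2 (isT : prime 3)) -Nk.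
  by rewrite dvdz_mulr.
- exact: Nk.
- move=> p pp pw pT pN.
  have ps : (p %| s)%Z.
    by apply: psW => //; rewrite -(rpredBl _ (dvdz_mull 10 pw)) -DT.
  have pd : (p %| d)%Z.
    have : (p %| 3 * b ^+ 2)%Z.
      have -> : 3 * b ^+ 2 = 4 * eis_norm a b - (2 * a - b) * (2 * a - b).
        by rewrite N4; ring.
      by rewrite rpredB ?dvdz_mull.
    by rewrite prime_dvdzM // prime_dvdzX // p3W // prime_dvdzM // p3W.
  (* At p = 2 the number 5 w - 3 v is odd, while its square differs from the even norm by an even
     number. *)
  have /eqP p2 := coprime_sd pp pw ps pd; rewrite p2 in pw ps pd pN.
  have := coprimez_primeP uw (isT : prime 2); have := coprimez_primeP vw (isT : prime 2).
  case/dvdzP: pd => d' Dd.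
  have : (2 %| (5 * w - 3 * v) * (5 * w - 3 * v))%Z.
    have -> : (5 * w - 3 * v) * (5 * w - 3 * v) = eis_norm a b
        - 2 * (18 * d' * d' - (5 * w - 3 * v) * 3 * d').
      by rewrite /a /b Dd /eis_norm; ring.
    by rewrite rpredB ?dvdz_mulr.
  rewrite (prime_dvdzM _ _ (isT : prime 2)) orbb; move: ps pw; rewrite /s; clear; lia.
- move=> p pp pw pk pN; rewrite DT.
  have -> : 10 * w - 3 * s = 15 * w - (5 * w + 3 * s) by ring.
  by rewrite Dk rpredB //; [apply: dvdz_mull | apply: dvdz_mulr].
exists x, y, (- c); split=> //; first by rewrite Dk Dk'; ring.
by rewrite -DT Da Db; ring.
Qed.

(* Here z1 = lam^3 (a + b om) with lam = 1 + 2 om, lam^2 = -3. *)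
Lemma step_3dvd : (3 %| w)%Z ->
  exists x, exists y, exists c,
  [/\ 5 * w + 3 * s = - 10 * c ^+ 3, w = c * eis_norm x y &
    10 * w - 3 * s = 2 * x ^+ 3 - 3 * (x ^+ 2 * y) - 3 * (x * y ^+ 2) + 2 * y ^+ 3].
Proof.
move=> w3; have u3 : ~~ (3 %| u)%Z.
  by apply/negP => u3; apply: (coprimez_primeP uw (isT : prime 3)).
have v3 : ~~ (3 %| v)%Z.
  by apply/negP => v3; apply: (coprimez_primeP vw (isT : prime 3)).
have E0 : s ^+ 3 - 3 * (u * v * s) + 5 * w ^+ 3 - 5 * (u * v * w) = 0.
  have /eqP := E; rewrite -subr_eq0 => /eqP E'; rewrite -[RHS]E' /s; ring.
have /dvdzP[w1 Dw1] := w3.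
(* The equation [E0] read modulo 3, 9 and 27 successively gives 3 | s, 9 | w and 3 | s' + 5 w'. *)
have /dvdzP[s' Ds] : (3 %| s)%Z.
  rewrite -(prime_dvdzX s 2 (isT : prime 3)); apply/dvdzP.
  exists (u * v * s - 5 * w ^+ 2 * w1 + 5 * u * v * w1); move: E0; rewrite Dw1 => E0.
  by apply/eqP; rewrite -subr_eq0 -[X in _ == X]E0; apply/eqP; ring.
have /dvdzP[w' Dw'] : (3 %| w1)%Z.
  have : (3 %| 5 * (u * v * w1))%Z.
    apply/dvdzP; exists (3 * s' ^+ 3 - u * v * s' + 15 * w1 ^+ 3).
    apply: (@mulfI _ 3) => //; move: E0; rewrite Dw1 Ds => E0.
    by apply/eqP; rewrite -subr_eq0 -oppr_eq0 -[X in _ == X]E0; apply/eqP; ring.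
  by rewrite !prime_dvdzM // (negPf u3) (negPf v3).
have {w1 Dw1 Dw'} Dw : w = 9 * w' by rewrite Dw1 Dw'; ring.
have /dvdzP[k0 Dk0] : (3 %| s' + 5 * w')%Z.
  have : (3 %| u * v * (s' + 5 * w'))%Z.
    apply/dvdzP; exists (s' ^+ 3 + 135 * w' ^+ 3).
    apply: (@mulfI _ 9) => //; move: E0; rewrite Dw Ds => E0.
    by apply/eqP; rewrite -subr_eq0 -oppr_eq0 -[X in _ == X]E0; apply/eqP; ring.
  by rewrite !prime_dvdzM // (negPf u3) (negPf v3).
have /dvdzP[k Dk] : (10 %| k0)%Z.
  by move: step_even step5 Dk0; rewrite Ds Dw; clear; lia.
have Du : u = 3 * s' - v by rewrite mulrC -Ds /s addrK.
have E9 : 3 * s' ^+ 3 - u * v * (s' + 5 * w') + 405 * w' ^+ 3 = 0.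
  apply: (@mulfI _ 9) => //; rewrite mulr0 -[RHS]E0 Dw Ds; ring.
pose a : int := v + 5 * w' - 2 * s'; pose b : int := 10 * w' - s'.
have Nk : eis_norm a b * k = (- w') ^+ 3.
  apply: (@mulfI _ 30) => //.
  transitivity (eis_norm a b * (s' + 5 * w')); first by rewrite Dk0 Dk; ring.
  apply/eqP; rewrite -subr_eq0 -[X in _ == X]E9 /a /b /eis_norm Du.
  by apply/eqP; ring.
have DT : 2 * a - b = - d by rewrite /a /b /d Du; ring.
have N4 : 4 * eis_norm a b = (2 * a - b) ^+ 2 + 3 * b ^+ 2 by rewrite /eis_norm; ring.
have N3 : ~~ (3 %| eis_norm a b)%Z.
  apply: contra v3 => N3; have : (3 %| v * v)%Z.
    have -> : v * v = eis_norm a b + 3 * (v * s' - s' * s' - 25 * w' * w' + 5 * w' * s').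
      by rewrite /a /b /eis_norm; ring.
    by rewrite rpredD // dvdz_mulr.
  by rewrite (prime_dvdzM _ _ (isT : prime 3)) orbb.
have [|||||x [y [c [Da Db Dk' Dw'']]]] := @eis_cube_factor a b k w'.
- by rewrite /b; move: Dk0; clear; lia.
- exact: N3.
- exact: Nk.
- move=> p pp pw pT pN; rewrite DT rpredN in pT.
  have p3 : (p %| 3)%Z = false.
    rewrite dvdzE dvdn_prime2 //; apply: contraNF N3 => /eqP /= p3.
    by rewrite p3 in pN.
  have pw0 : (p %| w)%Z by rewrite Dw dvdz_mull.
  have ps : (p %| s)%Z.
    have : (p %| 3 * b ^+ 2)%Z.
      have -> : 3 * b ^+ 2 = 4 * eis_norm a b - (2 * a - b) * (2 * a - b).
        by rewrite N4; ring.
      by rewrite DT rpredB ?dvdz_mull // rpredN.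
    rewrite prime_dvdzM // prime_dvdzX // p3 /= => pb; rewrite Ds dvdz_mulr //.
    by rewrite -[s'](subKr (10 * w')) rpredB // dvdz_mull.
  have /eqP p2 := coprime_sd pp pw0 ps pT; rewrite p2 in pw pw0 ps pT pN.
  have vodd := coprimez_primeP vw (isT : prime 2) _ pw0.
  have : (2 %| (v + 5 * w' - 2 * s') * (v + 5 * w' - 2 * s' - b))%Z.
    have -> : (v + 5 * w' - 2 * s') * (v + 5 * w' - 2 * s' - b) = eis_norm a b
        - b * b by rewrite /a /b /eis_norm; ring.
    rewrite rpredB ?dvdz_mull // /b; move: Ds ps pw; clear; lia.
  rewrite (prime_dvdzM _ _ (isT : prime 2)) /b; move: vodd Ds ps pw; clear; lia.
- move=> p pp pw pk pN.
  have ps' : (p %| s')%Z.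
    rewrite -[s'](addrK (5 * w')) rpredB ?dvdz_mull // Dk0 Dk dvdz_mulr //.
    by rewrite dvdz_mulr.
  have : (p %| (2 * a - b) ^+ 2)%Z.
    rewrite -[(2 * a - b) ^+ 2](addrK (3 * b ^+ 2)) -N4.
    apply: rpredB; apply: dvdz_mull => //; rewrite prime_dvdzX // /b.
    by apply: rpredB => //; apply: dvdz_mull.
  by rewrite prime_dvdzX.
(* These are the coordinates of lam (x + y om), which restores the factor lam^3. As N(lam) = 3, the
   factor 9 of w leaves 3 for c. *)
exists (x - 2 * y), (2 * x - y), (- 3 * c); split.
- by rewrite Dw Ds; transitivity (9 * (s' + 5 * w')); [ring | rewrite Dk0 Dk Dk'; ring].
- by rewrite Dw Dw'' /eis_norm; ring.
- by transitivity (9 * b); [rewrite /b Dw Ds; ring | rewrite Db; ring].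
Qed.

End Step.

Lemma cubic_curve_descent (u v w : int) :
    coprimez u v -> coprimez u w -> coprimez v w -> w != 0 ->
    u ^+ 3 + v ^+ 3 + 5 * w ^+ 3 = 5 * (u * v * w) ->
  exists P, exists Q, exists R, exists c : int,
    [/\ P + Q + R = 5 * c, P * Q * R = 5 * c ^+ 3, (c %| w)%Z & c != 0].
Proof.
move=> uv uw vw w0 E.
have [w3 | w3] := boolP (3 %| w)%Z.
  by have [x [y [c [e1 e2 e3]]]] := step_3dvd uv uw vw w0 E w3; apply: (step_finish w0 e1 e2 e3).
by have [x [y [c [e1 e2 e3]]]] := step_3ndvd uv uw vw w0 E w3; apply: (step_finish w0 e1 e2 e3).
Qed.

(* P + Q + R = 5 C, P Q R = 5 C^3 is the elliptic curve of the quintic; it is 3-isogenous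
   to u^3 + v^3 + 5 w^3 = 5 u v w, and passing through that curve and back decreases |C|. *)
Definition sum_prod_sol (P Q R C : int) := P + Q + R = 5 * C /\ P * Q * R = 5 * C ^+ 3.

(** P, Q and R / 5 are pairwise coprime with product C^3, so they are cubes u^3, v^3, w^3 with C = u
    v w. The sum condition becomes the equation of the isogenous curve, and the new C' divides w. *)
Lemma sum_prod_smaller (P Q R C : int) :
    coprimez P Q -> coprimez P R -> coprimez Q R -> C != 0 -> (5 %| R)%Z ->
    sum_prod_sol P Q R C ->
  exists P', exists Q', exists R', exists C',
    [/\ sum_prod_sol P' Q' R' C', (`|C'| < `|C|)%N & C' != 0].
Proof.
move=> PQ PR QR C0 /dvdzP[w3 DR] [sum prod].
have c3 : P * (Q * w3) = C ^+ 3 by apply: (@mulfI _ 5) => //; rewrite -prod DR; ring.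
have cPw : coprimez P w3 by move: PR; rewrite DR coprimezMr => /andP[].
have cQw : coprimez Q w3 by move: QR; rewrite DR coprimezMr => /andP[].
have [|u Du] := int_coprime_cube _ c3; first by rewrite coprimezMr PQ cPw.
have c3' : Q * (P * w3) = C ^+ 3 by rewrite -c3; ring.
have [|v Dv] := int_coprime_cube _ c3'; first by rewrite coprimezMr coprimez_sym PQ cQw.
have c3'' : w3 * (P * Q) = C ^+ 3 by rewrite -c3; ring.
have [|w Dw] := int_coprime_cube _ c3''.
  by rewrite coprimezMr ![coprimez w3 _]coprimez_sym cPw cQw.
have DC : C = u * v * w by apply: expz3_inj; rewrite -c3 Du Dv Dw; ring.
have w0 : w != 0 by apply: contraNneq C0 => w0; rewrite DC w0 mulr0.
have cop (a b : int) : coprimez (a ^+ 3) (b ^+ 3) -> coprimez a b.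
  by rewrite !exprS expr0 mulr1 !(coprimezMl, coprimezMr); case/andP=> /and3P[].
have E : u ^+ 3 + v ^+ 3 + 5 * w ^+ 3 = 5 * (u * v * w).
  by rewrite -DC -sum Du Dv DR Dw; ring.
have cuv : coprimez u v by apply: cop; rewrite -Du -Dv.
have cuw : coprimez u w by apply: cop; rewrite -Du -Dw.
have cvw : coprimez v w by apply: cop; rewrite -Dv -Dw.
have [P' [Q' [R' [c [sum' prod' cw c0]]]]] := cubic_curve_descent cuv cuw cvw w0 E.
exists P', Q', R', c; split=> //.
have [u0 v0] : u != 0 /\ v != 0.
  by move: C0; rewrite DC !mulf_eq0 !negb_or => /andP[/andP[]].
have cw' : (`|c| <= `|w|)%N by apply: dvdn_leq; rewrite ?absz_gt0 // -dvdzE.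
rewrite DC !abszM; apply: (leq_ltn_trans cw').
rewrite -[X in (X < _)%N]mul1n ltn_pmul2r ?absz_gt0 // ltn_neqAle eq_sym.
rewrite muln_gt0 !absz_gt0 u0 v0 !andbT muln_eq1; apply/negP.
(* |C'| = |C| would need |u| = |v| = 1. Then u = v fails modulo 5, and u = - v gives w (w^2 + 1) =
   0. *)
case/andP=> u1 v1; have w2 : 0 <= w ^+ 2 by apply: sqr_ge0.
have opp_case : 5 * w ^+ 3 <> - 5 * w.
  move=> e; have : 5 * w * (w ^+ 2 + 1) = 0.
    by rewrite mulrDr mulr1 -mulrA -exprS e; ring.
  by move/eqP; rewrite !mulf_eq0 (negPf w0) /=; move: (w ^+ 2) w2; clear; lia.
have [u1' | u1'] : u = 1 \/ u = - 1 by move: u1; clear; lia.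
  have [v1' | v1'] : v = 1 \/ v = - 1 by move: v1; clear; lia.
    by move: E; rewrite u1' v1'; move: (w ^+ 3) => w3'; clear; lia.
  by apply: opp_case; move: E; rewrite u1' v1'; move: (w ^+ 3) => w3'; clear; lia.
have [v1' | v1'] : v = 1 \/ v = - 1 by move: v1; clear; lia.
  by apply: opp_case; move: E; rewrite u1' v1'; move: (w ^+ 3) => w3'; clear; lia.
by move: E; rewrite u1' v1'; move: (w ^+ 3) => w3'; clear; lia.
Qed.

(** Infinite descent on |C|: a prime common to P, Q, R is divided out. Otherwise they are pairwise
    coprime, because a prime dividing two of them divides the third, and 5 divides one of them. *)
Lemma sum_prod_trivial (P Q R C : int) : sum_prod_sol P Q R C -> C = 0.
Proof.
have [n] := ubnP `|C|%N; elim: n => // n IHn in P Q R C *; rewrite ltnS => leC sol.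
apply/eqP; apply: contraT => C0.
have [sum prod] := sol.
have com (p : nat) : prime p -> (p %| P)%Z -> (p %| Q)%Z -> (p %| R)%Z -> False.
  move=> pp /dvdzP[P' DP] /dvdzP[Q' DQ] /dvdzP[R' DR].
  have pC : (p %| C)%Z.
    have p5 : (p %| 5 * C ^+ 3)%Z by rewrite -prod DR dvdz_mull // dvdz_mull.
    move: p5; rewrite prime_dvdzM // prime_dvdzX // => /orP[|//].
    (* For p = 5 the explicit factor 5 has to be discounted: 125 divides P Q R = 5 C^3, so 5 still
       divides C. *)
    rewrite dvdzE dvdn_prime2 //= => /eqP p5; rewrite p5 in DP DQ DR *.
    have : (5 %| C ^+ 3)%Z.
      apply/dvdzP; exists (5 * (P' * Q' * R')); apply: (@mulfI _ 5) => //.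
      by rewrite -prod DP DQ DR; ring.
    by rewrite (prime_dvdzX _ _ (isT : prime 5)).
  case/dvdzP: pC => C' DC; have p0 : p%:Z != 0 by have := prime_gt0 pp; clear; lia.
  have sol' : sum_prod_sol P' Q' R' C'.
    split; first by apply: (mulIf p0); rewrite -mulrA -DC -sum DP DQ DR; ring.
    have p30 : p%:Z ^+ 3 != 0 by rewrite expf_neq0.
    apply: (mulIf p30); transitivity (P * Q * R); first by rewrite DP DQ DR; ring.
    by rewrite prod DC; ring.
  have C'0 : C' != 0 by apply: contraNneq C0 => C'0; rewrite DC C'0 mul0r.
  have ltC : (`|C'| < `|C|)%N by rewrite DC abszM ltn_Pmulr ?absz_gt0 ?prime_gt1.
  by case/negP: C'0; apply/eqP; apply: (IHn P' Q' R' C' (leq_trans ltC leC) sol').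
have third (p : nat) (X Y Z : int) : prime p -> X + Y + Z = 5 * C ->
    X * Y * Z = 5 * C ^+ 3 -> (p %| X)%Z -> (p %| Y)%Z -> (p %| Z)%Z.
  move=> pp sumX prodX pX pY.
  have pC : (p %| 5 * C)%Z.
    have [p5 | p5] := eqVneq p 5%N; first by rewrite p5 dvdz_mulr.
    apply: dvdz_mull; have : (p %| 5 * C ^+ 3)%Z by rewrite -prodX -mulrA dvdz_mulr.
    by rewrite prime_dvdzM // prime_dvdzX // dvdzE dvdn_prime2 //= (negPf p5).
  have -> : Z = 5 * C - (X + Y) by rewrite -sumX; ring.
  by rewrite rpredB // rpredD.
have cPQ : coprimez P Q.
  by apply: coprimez_prime => p pp pP pQ; apply: (com p) => //; apply: (third p P Q R).
have cPR : coprimez P R.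
  apply: coprimez_prime => p pp pP pR; apply: (com p) => //; apply: (third p P R Q) => //.
    by rewrite -sum; ring.
  by rewrite -prod; ring.
have cQR : coprimez Q R.
  apply: coprimez_prime => p pp pQ pR; apply: (com p) => //; apply: (third p Q R P) => //.
    by rewrite -sum; ring.
  by rewrite -prod; ring.
have [P' [Q' [R' [C' [sol' ltC C'0]]]]] : exists P', exists Q', exists R', exists C',
    [/\ sum_prod_sol P' Q' R' C', (`|C'| < `|C|)%N & C' != 0].
  have : (5 %| P * Q * R)%Z by rewrite prod dvdz_mulr.
  rewrite !(prime_dvdzM _ _ (isT : prime 5)) => /orP[/orP[p5|p5]|p5].
  - apply: (@sum_prod_smaller Q R P C) => //; rewrite 1?coprimez_sym //.
    by split; [rewrite -sum; ring | rewrite -prod; ring].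
  - apply: (@sum_prod_smaller P R Q C) => //; rewrite 1?coprimez_sym //.
    by split; [rewrite -sum; ring | rewrite -prod; ring].
  - exact: (@sum_prod_smaller P Q R C).
by case/negP: C'0; apply/eqP; apply: (IHn P' Q' R' C' (leq_trans ltC leC) sol').
Qed.

(* The integral points of the elliptic curve underlying the quintic (conductor 50,
   rank 0), put in the form Y (Y + 5 X + 5) = X^3. *)
Lemma cubic_integral_points (X Y : int) : Y * (Y + 5 * X + 5) = X ^+ 3 -> X = 0.
Proof.
move=> e; apply/eqP; rewrite -oppr_eq0; apply/eqP.
apply: (@sum_prod_trivial Y (- (Y + 5 * X + 5)) 5 (- X)); split; first by ring.
by rewrite mulrN e; ring.
Qed.

(* The discriminant of the quintic, as a polynomial in t, is
   (x + 3)^2 (4 x^3 + x^2 - 2 x - 7). *)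
Lemma quintic_integer_root (x t : int) :
  x ^+ 5 + 10 * x ^+ 3 - 5 * t * x ^+ 2 - 15 * x - t ^+ 2 + t - 16 = 0 ->
  t = 3 \/ t = -22.
Proof.
move=> e; have [x3 | x3] := eqVneq x (-3).
  right; move: e; rewrite x3 => e; have : (t + 22) ^+ 2 = 0.
    by apply/eqP; rewrite -oppr_eq0 -[X in _ == X]e; apply/eqP; ring.
  by move=> /eqP; rewrite sqrf_eq0 addr_eq0 => /eqP.
have e2 : (2 * t + 5 * x ^+ 2 - 1) ^+ 2
    = (x + 3) ^+ 2 * (4 * x ^+ 3 + x ^+ 2 - 2 * x - 7).
  by apply/eqP; rewrite -subr_eq0 -[X in _ == X](mulr0 (-4)) -[in X in _ == X]e; apply/eqP; ring.
have /dvdzP[z Dz] : (x + 3 %| 2 * t + 5 * x ^+ 2 - 1)%Z.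
  by rewrite -(@dvdz_pexp2r _ _ 2) // e2 dvdz_mulr.
have x30 : (x + 3) ^+ 2 != 0 by rewrite expf_neq0 // addr_eq0.
have {e2} e2 : z ^+ 2 = 4 * x ^+ 3 + x ^+ 2 - 2 * x - 7.
  by apply: (mulfI x30); rewrite -e2 Dz; ring.
(* In X = x - 2 the cubic is 4 X^3 + (5 X + 5)^2, so writing z = 2 y + 5 X + 5 gives y (y + 5 X + 5)
   = X^3. *)
have /dvdzP[y Dy] : (2 %| z - 5 * x + 5)%Z.
  have : (2 %| (z + x + 1) ^+ 2)%Z.
    apply/dvdzP; exists (2 * x ^+ 3 + x ^+ 2 - 3 + z * x + z).
    transitivity (z ^+ 2 + (x + 1) ^+ 2 + 2 * (z * x + z)); first by ring.
    by rewrite e2; ring.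
  by rewrite (prime_dvdzX _ _ (isT : prime 2)); clear; lia.
have Dz' : z = 2 * y + 5 * x - 5 by move: Dy; clear; lia.
have x2 : x = 2.
  apply/eqP; rewrite -subr_eq0; apply/eqP; apply: (@cubic_integral_points _ y).
  apply: (@mulfI _ 4) => //; apply/eqP; rewrite -subr_eq0; apply/eqP.
  transitivity (z ^+ 2 - (4 * x ^+ 3 + x ^+ 2 - 2 * x - 7)); last by rewrite e2 subrr.
  by rewrite Dz'; ring.
have : (t - 3) * (t + 22) = 0.
  by apply/eqP; rewrite -oppr_eq0 -[X in _ == X]e x2; apply/eqP; ring.
by move=> /eqP; rewrite mulf_eq0 subr_eq0 addr_eq0 => /orP[]/eqP; auto.
Qed.

(** * Prime ideals unramified over a quadratic field *)

Section IdealMul.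

Variables (L : fieldExtType rat) (I J : L -> Prop).

Lemma ideal_mul0 : ideal_mul I J 0.
Proof. by exists [::] => //; rewrite big_nil. Qed.

Lemma ideal_mulD x y : ideal_mul I J x -> ideal_mul I J y -> ideal_mul I J (x + y).
Proof.
move=> [s Is ->] [s' Is' ->]; exists (s ++ s'); last by rewrite big_cat.
by move=> u; rewrite mem_cat => /orP[/Is | /Is'].
Qed.

Lemma ideal_mul_incl a b : I a -> J b -> ideal_mul I J (a * b).
Proof.
move=> Ia Jb; exists [:: (a, b)]; last by rewrite big_seq1.
by move=> u; rewrite inE => /eqP->.
Qed.

Lemma ideal_mul_sum (T : eqType) (r : seq T) (F : T -> L) :
  (forall i, i \in r -> ideal_mul I J (F i)) -> ideal_mul I J (\sum_(i <- r) F i).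
Proof.
elim: r => [|i r IHr] IF; first by rewrite big_nil; apply: ideal_mul0.
rewrite big_cons; apply: ideal_mulD; first by apply: IF; rewrite mem_head.
by apply: IHr => j rj; apply: IF; rewrite inE rj orbT.
Qed.

Lemma ideal_mul_ind (Q : L -> Prop) : Q 0 ->
    (forall x y, Q x -> Q y -> Q (x + y)) ->
    (forall a b, I a -> J b -> Q (a * b)) ->
  forall x, ideal_mul I J x -> Q x.
Proof.
move=> Q0 QD QM x [s Is ->]; elim: s => [|u s IHs] in Is *; first by rewrite big_nil.
rewrite big_cons; apply: QD; first by have [] := Is u (mem_head _ _); apply: QM.
by apply: IHs => v sv; apply: Is; rewrite inE sv orbT.
Qed.

End IdealMul.

Section Integers.

Variable L : splittingFieldType rat.
Local Notation O := (@ring_of_integers L).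
Implicit Types (x y : L).

Lemma integers_int (n : int) : O n%:~R. Proof. exact: integral_id. Qed.
Lemma integers0 : O 0. Proof. exact: integral0. Qed.
Lemma integers1 : O 1. Proof. exact: integral1. Qed.
Lemma integersD x y : O x -> O y -> O (x + y). Proof. exact: integral_add. Qed.
Lemma integersN x : O x -> O (- x). Proof. exact: integral_opp. Qed.
Lemma integersB x y : O x -> O y -> O (x - y). Proof. exact: integral_sub. Qed.
Lemma integersM x y : O x -> O y -> O (x * y). Proof. exact: integral_mul. Qed.
Lemma integersX x n : O x -> O (x ^+ n).
Proof. by move=> Ox; elim: n => [|n IHn]; [apply: integers1 | rewrite exprS; apply: integersM]. Qed.

Lemma integers_rmorph (f : {rmorphism L -> L}) x : O x -> O (f x).
Proof.
case=> p p_monic; rewrite /root => px; exists p => //.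
rewrite /root -[X in _ == X](rmorph0 f) -(eqP px) -horner_map -map_poly_comp.
by apply/eqP; congr (_.[_]); apply: eq_map_poly => n /=; rewrite rmorph_int.
Qed.

(** The embedding transports the question to [algC], where rational algebraic integers are known to
    be integers. *)
Lemma integers_rat (iota : {rmorphism L -> algC}) x :
  x \in 1%VS -> O x -> exists n : int, x = n%:~R.
Proof.
case/vlineP=> r ->; case=> p p_monic px.
suff /intrP[n Dn] : iota r%:A \in Num.int.
  by exists n; apply: (fmorph_inj iota); rewrite rmorph_int.
apply: Cint_rat_Aint; first by rewrite alg_num_field fmorph_rat Crat_rat.
apply: (@root_monic_Aint (map_poly intr p)); last 2 first.
- by rewrite monic_map //.
- by apply/polyOverP => i; rewrite coef_map intr_int.
rewrite /root; have := fmorph_root iota (map_poly intr p) r%:A; rewrite px.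
by rewrite -map_poly_comp (eq_map_poly (g := intr)) // => n /=; rewrite rmorph_int.
Qed.

End Integers.

(** * Descent of P^2 to the base field by traces *)

Section Etale.

Variables (L : splittingFieldType rat) (K : {subfield L}) (P : L -> Prop).
Hypotheses (galK : galois K {:L}) (Pp : nonzero_prime_ideal P).
Local Notation O := (@ring_of_integers L).
Local Notation G := 'Gal({:L} / K)%g.

Let PO x : P x -> O x. Proof. by case: Pp => [[]] + _ _ _ _ _ _; apply. Qed.
Let P0 : P 0. Proof. by case: Pp => [[]]. Qed.
Let PD x y : P x -> P y -> P (x + y). Proof. by case: Pp => [[]] _ _ + _ _ _ _; apply. Qed.
Let PM a x : O a -> P x -> P (a * x). Proof. by case: Pp => [[]] _ _ _ + _ _ _; apply. Qed.
Let PMr a x : P x -> O a -> P (x * a). Proof. by move=> Px Oa; rewrite mulrC; apply: PM. Qed.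
Let P1 : ~ P 1. Proof. by case: Pp. Qed.
Let Pprime a b : O a -> O b -> P (a * b) -> P a \/ P b.
Proof. by case: Pp => _ _ _; apply. Qed.

Let nPM a b : O a -> O b -> ~ P a -> ~ P b -> ~ P (a * b).
Proof. by move=> Oa Ob nPa nPb /Pprime[]. Qed.

(* The pairs in ts are the terms of the tensor prod_g (g th_g (x) 1 - 1 (x) th_g),
   which is killed by x (x) y |-> x h(y) for h in s. *)
Lemma tensor_separation (s : seq (gal_of {:L})) :
    (forall g, g \in s -> exists2 th, O th & ~ P (g th - th)) ->
  exists ts : seq (L * L), exists2 de,
    [/\ forall u, u \in ts -> O u.1 /\ O u.2, O de & ~ P de] &
    \sum_(u <- ts) u.1 * u.2 = de /\
    (forall h, h \in s -> \sum_(u <- ts) u.1 * h u.2 = 0).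
Proof.
elim: s => [|g s IHs] sP.
  exists [:: (1, 1)], 1; last by rewrite big_seq1 mulr1.
  by split=> //; [move=> u; rewrite inE => /eqP-> /= | ]; try split; apply: integers1.
have [th Oth nPth] := sP g (mem_head _ _).
have [|ts [de [Ots Ode nPde] [Dde hs]]] := IHs.
  by move=> h sh; apply: sP; rewrite inE sh orbT.
pose ts' := [seq (g th * u.1, u.2) | u <- ts] ++ [seq (- u.1, th * u.2) | u <- ts].
have tsE (h : {rmorphism L -> L}) : \sum_(u <- ts') u.1 * h u.2
    = (g th - h th) * \sum_(u <- ts) u.1 * h u.2.
  rewrite big_cat !big_map /= mulrBl !big_distrr -sumrB -big_split /=.
  by apply: eq_bigr => u _; rewrite rmorphM; ring.
have Ogth : O (g th) by apply: integers_rmorph.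
exists ts', ((g th - th) * de).
  split; last by apply: nPM => //; apply: integersB.
    move=> u; rewrite mem_cat => /orP[] /mapP[v /Ots[Ov1 Ov2] ->] /=; split=> //.
    - exact: integersM.
    - exact: integersN.
    - exact: integersM.
  by apply: integersM => //; apply: integersB.
split; first by rewrite -Dde -(tsE idfun).
move=> h; rewrite inE tsE => /orP[/eqP-> | sh]; first by rewrite subrr mul0r.
by rewrite hs ?mulr0.
Qed.

Let Tr (z : L) := \sum_(g in G) g z.

Let TrK z : Tr z \in K. Proof. exact: mem_galTrace (memvf _). Qed.
Let TrD x y : Tr (x + y) = Tr x + Tr y.
Proof. by rewrite -big_split; apply: eq_bigr => g _; rewrite rmorphD. Qed.
Let Tr0 : Tr 0 = 0. Proof. by apply: big1 => g _; rewrite rmorph0. Qed.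
Let TrKl k z : k \in K -> Tr (k * z) = k * Tr z.
Proof.
move=> Kk; rewrite /Tr big_distrr; apply: eq_bigr => g Gg /=.
by rewrite rmorphM; congr (_ * _); apply: fixed_gal (subvf K) Gg Kk.
Qed.
Let TrO z : O z -> O (Tr z).
Proof. by move=> Oz; apply: (big_ind O); [apply: integers0 | apply: integersD | move=> g _; apply: integers_rmorph]. Qed.
Let TrP z : (forall g, g \in G -> P (g z)) -> P (Tr z).
Proof. by move=> Pz; apply: (big_ind P); [apply: P0 | apply: PD | apply: Pz]. Qed.

(** An automorphism of finite order is a power of its inverse. *)
Lemma prime_conj_sub (h : gal_of {:L}) :
  (forall x, P x -> P ((h^-1)%g x)) -> forall x, P x -> P (h x).
Proof.
move=> hP; have hPn n x : P x -> P ((h^-1 ^+ n)%g x).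
  by move=> Px; elim: n => [|n IHn]; rewrite ?expg0 ?gal_id // expgSr galM ?memvf //; apply: hP.
have Dh : (h^-1 ^+ #[h^-1].-1 = h)%g.
  by apply: (mulIg h^-1%g); rewrite -expgSr prednK ?order_gt0 // expg_order mulgV.
by move=> x Px; rewrite -[h]Dh; apply: hPn.
Qed.

(** Automorphisms are treated one at a time and the multipliers combined, as P is prime. If h does
    not preserve P, some x in P has r = h^-1 x outside P, and h (r y) = x h(y) lies in P. *)
Lemma conj_avoidance (s : seq (gal_of {:L})) : exists q, [/\ O q, ~ P q &
  forall h, h \in s -> forall x, P x -> P (h (q * x))].
Proof.
elim: s => [|h s [q [Oq nPq qP]]]; first by exists 1; split=> //; apply: integers1.
suff [r [Or nPr rP]] : exists r, [/\ O r, ~ P r & forall x, P x -> P (h (r * x))].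
  exists (r * q); split; [exact: integersM | exact: nPM | ].
  move=> h'; rewrite inE => /orP[/eqP-> x Px | sh' x Px].
    by rewrite -mulrA; apply/rP/PM.
  rewrite [r * q]mulrC -mulrA rmorphM rmorphM mulrCA -rmorphM.
  by apply: PM; [apply: integers_rmorph | apply: qP].
have [hP | nhP] := classic (forall x, P x -> P (h x)).
  by exists 1; split=> //; [apply: integers1 | move=> x Px; rewrite mul1r; apply: hP].
have [x [Px nPx]] : exists x, P x /\ ~ P ((h^-1)%g x).
  apply: NNPP => none; case: nhP; apply: prime_conj_sub => x Px.
  by apply: NNPP => nPx; case: none; exists x.
exists ((h^-1)%g x); split=> //; first by apply/integers_rmorph/PO.
move=> y Py; rewrite rmorphM -[X in X * _](galM _ _ (memvf x)) mulVg gal_id.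
by apply: PMr => //; apply/integers_rmorph/PO.
Qed.

Let p (x : L) := P x /\ x \in K.

(* With p = P /\ K and R the intersection of the conjugates of P, the tensor above gives
   de R <= p O_L, and q P <= R; tracing de^2 q^2 z for z in P^2 down to K lands in p^2. *)
Lemma square_ideal_descends :
    (forall g, g \in G -> g != 1%g -> exists2 th, O th & ~ P (g th - th)) ->
    (forall x, below_ext K P x -> ideal_exp P 2 x) ->
  exists m, [/\ O m, m \in K, ~ P m & forall z, p z -> ideal_mul p p (z * m)].
Proof.
move=> sep ram.
have [|ts [de [Ots Ode nPde] [Dde hs]]] := @tensor_separation (enum [pred g in G | g != 1%g]).
  by move=> g; rewrite mem_enum => /andP[]; apply: sep.
have [q [Oq nPq qP]] := conj_avoidance (enum G).
(* In the expanded trace the terms with g != 1 are killed by the choice of [ts]; g = 1 contributes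
   de x. *)
have tsTr x : \sum_(u <- ts) u.1 * Tr (u.2 * x) = de * x.
  under eq_bigr => u _ do rewrite /Tr big_distrr.
  rewrite exchange_big (bigD1 1%g) ?group1 //= [X in _ + X]big1 ?addr0.
    by rewrite -Dde big_distrl; apply: eq_bigr => u _; rewrite gal_id mulrA.
  move=> g /andP[Gg g1]; transitivity ((\sum_(u <- ts) u.1 * g u.2) * g x).
    by rewrite big_distrl; apply: eq_bigr => u _ /=; rewrite rmorphM mulrA.
  by rewrite hs ?mul0r // mem_enum; apply/andP.
have Oc : O (de * q) by apply: integersM.
have nPc : ~ P (de * q) by apply: nPM.
pose c := de * q; have trp y x : O y -> P x -> p (Tr (y * (q * x))).
  move=> Oy Px; split=> //; apply: TrP => g Gg; rewrite rmorphM.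
  by apply: PM; [apply: integers_rmorph | apply: qP => //; rewrite mem_enum].
have cTr y z : O y -> ideal_exp P 2 z -> ideal_mul p p (Tr (c * c * z * y)).
  move=> Oy; move: z; apply: ideal_mul_ind => [|x1 x2 I1 I2|a b' Pa].
  - by rewrite mulr0 mul0r Tr0; apply: ideal_mul0.
  - by rewrite mulrDr mulrDl TrD; apply: ideal_mulD.
  (* [ideal_exp P 2] is P (P O), whence the second induction. *)
  move: b'; apply: ideal_mul_ind => [|x1 x2 I1 I2|b r Pb Or].
  - by rewrite !mulr0 mul0r Tr0; apply: ideal_mul0.
  - by rewrite !mulrDr mulrDl TrD; apply: ideal_mulD.
  (* The factor de (q a) expands by [tsTr] into terms u.1 Tr(u.2 q a). These inner traces lie in K
     and move out of the outer trace, leaving a product of two traces, each in p. *)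
  have -> : c * c * (a * (b * r)) * y = (de * (q * a)) * ((de * (q * b)) * (r * y)).
    by rewrite /c; ring.
  rewrite -tsTr big_distrl /= (big_morph Tr TrD Tr0).
  apply: ideal_mul_sum => u /Ots[Ou1 Ou2].
  rewrite mulrAC mulrC TrKl ?TrK //; apply: ideal_mul_incl; first exact: trp.
  have -> : u.1 * (de * (q * b) * (r * y)) = (de * r * y * u.1) * (q * b) by ring.
  by apply: trp => //; do ![apply: integersM => //].
(* If all these traces lay in P, [tsTr] at x = c^2 would put de c^2 in P. *)
have [y [Oy nPy]] : exists y, O y /\ ~ P (Tr (c * c * y)).
  apply: NNPP => none; have : P (de * (c * c)); last by apply: nPM => //; [apply: integersM | apply: nPM].
  rewrite -tsTr big_seq; apply: (big_ind P); [exact: P0 | exact: PD | move=> u /Ots[Ou1 Ou2]].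
  apply: PM => //; apply: NNPP => nPu; case: none; exists u.2; split=> //.
  by rewrite mulrC.
exists (Tr (c * c * y)); split=> //.
  by apply/TrO/integersM => //; apply: integersM.
move=> z [Pz Kz]; rewrite -TrKl //.
have -> : z * (c * c * y) = c * c * z * y by ring.
apply: cTr => //; apply: ram.
rewrite -[z]mulr1; apply: ideal_mul_incl; first by split.
exact: integers1.
Qed.

End Etale.

Lemma pchar_fieldExt_rat (L : fieldExtType rat) : [pchar L] =i pred0.
Proof. by move=> n; rewrite pchar_lalg; apply: pchar_num. Qed.

Lemma natf_eq0 (L : fieldExtType rat) (n : nat) : (n%:R == 0 :> L) = (n == 0%N).
Proof. exact: (pcharf0P L).1 (@pchar_fieldExt_rat L) n. Qed.

Lemma intf_eq0 (L : fieldExtType rat) (n : int) : (n%:~R == 0 :> L) = (n == 0).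
Proof.
by case: n => n; rewrite ?NegzE ?rmorphN ?oppr_eq0 /= natf_eq0.
Qed.

Lemma galois_rat (L : splittingFieldType rat) (K : {subfield L}) : galois K {:L}.
Proof.
rewrite /galois subvf normalFieldf andbT; apply/separableP => y _.
by apply/pcharf0_separable/pchar_fieldExt_rat.
Qed.

Lemma integral_quadratic (L : splittingFieldType rat) (x : L) (T N : int) :
  x ^+ 2 - T%:~R * x + N%:~R = 0 -> ring_of_integers x.
Proof.
move=> ex; pose q : {poly int} := 'X^2 + (- T%:P * 'X + N%:P).
exists q; last first.
  rewrite /root /q 2!rmorphD /= map_polyXn rmorphM /= map_polyX rmorphN /= !map_polyC /=.
  by apply/eqP; rewrite !hornerE /= -[RHS]ex mulNr.
rewrite monicE lead_coefDl ?lead_coefXn // size_polyXn ltnS.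
rewrite (leq_trans (size_polyD _ _)) // geq_max -polyCN mul_polyC.
by rewrite (leq_trans (size_scale_leq _ _)) ?size_polyX // (leq_trans (size_polyC_leq1 _)).
Qed.

(** * A prime of a quadratic field is not contained in its square *)

Section QuadraticBase.

Variables (L : splittingFieldType rat) (iota : {rmorphism L -> algC}) (K : {subfield L}).
Variables (P : L -> Prop) (c : {rmorphism L -> L}).
Hypothesis Pp : nonzero_prime_ideal P.
Hypotheses (cK : forall z, z \in K -> c z \in K)
  (ctr : forall z, z \in K -> z + c z \in 1%VS)
  (cnorm : forall z, z \in K -> z * c z \in 1%VS).
Local Notation O := (@ring_of_integers L).

Let PO x : P x -> O x. Proof. by case: Pp => [[]] + _ _ _ _ _ _; apply. Qed.
Let P0 : P 0. Proof. by case: Pp => [[]]. Qed.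
Let PD x y : P x -> P y -> P (x + y). Proof. by case: Pp => [[]] _ _ + _ _ _ _; apply. Qed.
Let PM a x : O a -> P x -> P (a * x). Proof. by case: Pp => [[]] _ _ _ + _ _ _; apply. Qed.
Let PMr a x : P x -> O a -> P (x * a). Proof. by move=> Px Oa; rewrite mulrC; apply: PM. Qed.
Let PN x : P x -> P (- x). Proof. by rewrite -mulN1r; apply: PM; apply/integersN/integers1. Qed.
Let P1 : ~ P 1. Proof. by case: Pp. Qed.
Let Pprime a b : O a -> O b -> P (a * b) -> P a \/ P b.
Proof. by case: Pp => _ _ _; apply. Qed.

(** The norm to Q of a nonzero element of P is a nonzero integer in P; primality of P then isolates
    one of its prime factors. *)
Lemma prime_ideal_over : exists2 l : nat, prime l & P l%:R.
Proof.
have [x Px x0] : exists2 x, P x & x != 0 by case: Pp.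
have [n n0 Pn] : exists2 n : nat, (0 < n)%N & P n%:R.
  have galL := galois_rat 1%AS : galois 1%AS {:L}.
  pose y := \prod_(g in 'Gal({:L} / 1%AS)%g | g != 1%g) g x.
  have Oy : O y by apply: (big_ind O); [apply: integers1 | apply: integersM | move=> g _; apply/integers_rmorph/PO].
  have Dxy : galNorm 1%AS {:L} x = x * y by rewrite /galNorm (bigD1 1%g) ?group1 //= gal_id.
  have Pxy : P (x * y) by apply: PMr.
  have [|m Dm] := @integers_rat L iota (x * y) _ (PO Pxy).
    by rewrite -Dxy; apply: mem_galNorm (memvf _).
  have m0 : m != 0.
    apply: contraNneq x0 => m0; rewrite -(galNorm_eq0 1%AS {:L}) Dxy Dm m0.
    by rewrite eqxx.
  exists `|m|%N; first by rewrite absz_gt0.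
  move: Pxy; rewrite Dm; case: (m) => k // /PN.
  by rewrite NegzE rmorphN opprK.
have [m] := ubnP n; elim: m => // m IHm in n n0 Pn *; rewrite ltnS => lenm.
have n1 : (1 < n)%N by case: n n0 Pn {lenm} => [|[|n]] // _ /P1.
have /dvdnP[k Dk] := pdiv_dvd n.
have kn : (0 < k)%N by rewrite Dk muln_gt0 in n0; case/andP: n0.
have := Pn; rewrite Dk natrM => /Pprime[||Pk|Pp'] //; try exact: (integers_int L (_ : nat)).
  apply: (IHm k kn Pk); apply: leq_trans lenm.
  by rewrite Dk ltn_Pmulr // prime_gt1 // pdiv_prime // -Dk.
by exists (pdiv n) => //; apply: pdiv_prime.
Qed.

Let p (x : L) := P x /\ x \in K.

(** Otherwise p = p^2. Since p c(p) lies in l O, this gives l^2 | z c(z) for every z in p; comparing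
    z with z + l shows that l divides the trace of z. So z / l is integral, p lies in l O, and l in
    p = p^2 lies in l^2 O, which makes 1 / l integral. *)
Lemma square_ideal_proper m : O m -> m \in K -> ~ P m ->
  ~ (forall z, p z -> ideal_mul p p (z * m)).
Proof.
move=> Om Km nPm sq.
have [l pl Pl] := prime_ideal_over.
have l0 : l%:R != 0 :> L by rewrite natf_eq0; case: (l) pl.
have Ol : O l%:R := integers_int L l.
have PI (n : int) : P n%:~R -> (l %| n)%Z.
  move=> Pn; apply: contraT => ln.
  have : coprimez l n by rewrite coprimezE prime_coprime.
  case/coprimezP=> [[u v]] /= uv; case: P1.
  rewrite (_ : 1 = u%:~R * l%:R + v%:~R * n%:~R :> L).
    by apply: PD; apply: PM => //; apply: integers_int.
  by transitivity (1%:~R : L); rewrite // -uv intrD !intrM.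
have InvP (n : int) : ~ P n%:~R -> exists2 n' : int, True & P (1 - n%:~R * n'%:~R).
  move=> nPn; have ln : ~~ (l %| n)%Z.
    by apply/negP => /dvdzP[k Dk]; case: nPn; rewrite Dk intrM; apply: PM => //; apply: integers_int.
  have : coprimez l n by rewrite coprimezE prime_coprime.
  case/coprimezP=> [[u v]] /= uv; exists v => //.
  rewrite (_ : 1 - _ = u%:~R * l%:R); first by apply: PM => //; apply: integers_int.
  transitivity (1%:~R - n%:~R * v%:~R : L) => //; rewrite -uv intrD !intrM.
  by rewrite [n%:~R * _]mulrC addrK.
have tr_int z : O z -> z \in K -> exists T : int, z + c z = T%:~R.
  by move=> Oz Kz; apply: (integers_rat iota); [apply: ctr | apply: integersD => //; apply: integers_rmorph].
have norm_int z : O z -> z \in K -> exists N : int, z * c z = N%:~R.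
  by move=> Oz Kz; apply: (integers_rat iota); [apply: cnorm | apply: integersM => //; apply: integers_rmorph].
(* p is maximal in the integers of K, so p is contained in its square. *)
have [m' [Om' Km' mm']] : exists m', [/\ O m', m' \in K & P (1 - m * m')].
  have [N DN] := norm_int m Om Km; have [T DT] := tr_int m Om Km.
  (* If the norm of m lies in P, then m is congruent to its trace, an integer, as m (m - T) = - N.
     Otherwise c(m) inverts m up to the integer N. *)
  have [PN' | nPN] := classic (P N%:~R).
    have PmT : P (m - T%:~R).
      have : P (m * (m - T%:~R)).
        by rewrite (_ : _ * _ = - N%:~R); [apply: PN | rewrite -DN -DT; ring].
      by case/Pprime => //; apply: integersB => //; apply: integers_int.
    have nPT : ~ P T%:~R.
      by move=> PT; apply: nPm; rewrite -[m](subrK T%:~R); apply: PD.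
    have [n _ Pn] := InvP T nPT; exists n%:~R; split; rewrite ?rpred_int //; first exact: integers_int.
    rewrite (_ : 1 - _ = (1 - T%:~R * n%:~R) - (m - T%:~R) * n%:~R); last by ring.
    by apply: PD => //; apply/PN/PMr => //; apply: integers_int.
  have [n _ Pn] := InvP N nPN; exists (c m * n%:~R); split.
  - by apply: integersM; [apply: integers_rmorph | apply: integers_int].
  - by rewrite rpredM ?rpred_int ?cK.
  - by rewrite mulrA DN.
have psq z : p z -> ideal_mul p p z.
  move=> [Pz Kz]; rewrite (_ : z = z * m * m' + z * (1 - m * m')); last by ring.
  apply: ideal_mulD.
    apply: (ideal_mul_ind (Q := fun x => ideal_mul p p (x * m'))); last exact: sq.
    - by rewrite mul0r; apply: ideal_mul0.
    - by move=> x y Ix Iy; rewrite mulrDl; apply: ideal_mulD.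
    move=> a b [Pa Ka] [Pb Kb]; rewrite -mulrA; apply: ideal_mul_incl; split=> //.
      exact: PMr.
    by rewrite rpredM.
  apply: ideal_mul_incl; split=> //.
  by rewrite rpredB ?rpredM ?mem1v.
(* a c(b) / l is a root of X^2 - (T/l) X + N(a)N(b)/l^2. *)
have l_dvd a b : p a -> p b -> O (a * c b / l%:R).
  move=> [Pa Ka] [Pb Kb]; have [Oa Ob] := (PO Pa, PO Pb).
  have [Na DNa] := norm_int a Oa Ka; have [Nb DNb] := norm_int b Ob Kb.
  have [Nab DNab] := norm_int (a + b) (integersD Oa Ob) (rpredD Ka Kb).
  have /dvdzP[na Ena] : (l %| Na)%Z.
    by apply: PI; rewrite -DNa; apply/PMr/integers_rmorph.
  have /dvdzP[nb Enb] : (l %| Nb)%Z.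
    by apply: PI; rewrite -DNb; apply/PMr/integers_rmorph.
  have /dvdzP[nab Enab] : (l %| Nab)%Z.
    by apply: PI; rewrite -DNab; apply: PMr; [apply: PD | apply/integers_rmorph/integersD].
  pose T := nab - na - nb; pose N := na * nb.
  apply: (integral_quadratic (T := T) (N := N)).
  rewrite /T /N !(intrB, intrM).
  have lE : (l%:Z)%:~R = l%:R :> L by [].
  have E1 : na%:~R * l%:R = a * c a by rewrite DNa Ena intrM.
  have E2 : nb%:~R * l%:R = b * c b by rewrite DNb Enb intrM.
  have E3 : nab%:~R * l%:R = (a + b) * (c a + c b) by rewrite -rmorphD DNab Enab intrM.
  apply: (@mulfI _ (l%:R ^+ 2)); first by rewrite expf_neq0.
  transitivity ((a * c b) ^+ 2 - (nab%:~R * l%:R - na%:~R * l%:R - nb%:~R * l%:R) * (a * c b)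
    + (na%:~R * l%:R) * (nb%:~R * l%:R)); first by field.
  by rewrite E1 E2 E3; ring.
have l2_dvd z z' : ideal_mul p p z -> ideal_mul p p z' -> O (z * c z' / l%:R ^+ 2).
  move=> Iz; move: z'; apply: ideal_mul_ind.
  - by rewrite rmorph0 mulr0 mul0r; apply: integers0.
  - by move=> x y Ox Oy; rewrite rmorphD mulrDr mulrDl; apply: integersD.
  move=> a' b' pa' pb'; move: z Iz; apply: ideal_mul_ind.
  - by rewrite !mul0r; apply: integers0.
  - by move=> x y Ox Oy; rewrite !mulrDl; apply: integersD.
  move=> a b pa pb; rewrite rmorphM.
  rewrite (_ : _ / _ = (a * c a' / l%:R) * (b * c b' / l%:R)); last by field.
  by apply: integersM; apply: l_dvd.
have l_div z : p z -> O (z / l%:R).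
  move=> pz; have [Pz Kz] := pz; have Oz := PO Pz.
  have pl' : p l%:R by split=> //; rewrite rpred_nat.
  have pzl : p (z + l%:R) by split; [apply: PD | rewrite rpredD ?rpred_nat].
  have O1' := l2_dvd _ _ (psq _ pz) (psq _ pz).
  have O2' := l2_dvd _ _ (psq _ pzl) (psq _ pzl).
  have [T DT] := tr_int z Oz Kz.
  have OT : O (T%:~R / l%:R).
    rewrite (_ : _ / _ = (z + l%:R) * c (z + l%:R) / l%:R ^+ 2 - z * c z / l%:R ^+ 2 - 1).
      by apply: integersB; [apply: integersB | apply: integers1].
    by rewrite -DT rmorphD rmorph_nat; field.
  have [N DN] : exists N : int, z * c z / l%:R ^+ 2 = N%:~R.
    by apply: (integers_rat iota) => //; rewrite rpredM ?cnorm // rpredV rpredX ?rpred_nat.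
  have [T' DT'] : exists T' : int, T%:~R / l%:R = T'%:~R :> L.
    by apply: (integers_rat iota) => //; rewrite rpredM ?rpred_int // rpredV rpred_nat.
  apply: (integral_quadratic (T := T') (N := N)).
  by rewrite -DN -DT' -DT; field.
have Olinv : O l%:R^-1.
  have pl' : p l%:R by split=> //; rewrite rpred_nat.
  rewrite (_ : _^-1 = l%:R / l%:R ^+ 2); last by field.
  apply: (ideal_mul_ind (Q := fun x => O (x / l%:R ^+ 2))); last exact: (psq _ pl').
  - by rewrite mul0r; apply: integers0.
  - by move=> x y Ox Oy; rewrite mulrDl; apply: integersD.
  move=> a b pa pb; rewrite (_ : _ / _ = (a / l%:R) * (b / l%:R)); last by field.
  by apply: integersM; apply: l_div.
have [n Dn] : exists n : int, l%:R^-1 = n%:~R :> L.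
  by apply: (integers_rat iota) => //; rewrite rpredV rpred_nat.
have /eqP : (l%:Z * n - 1)%:~R = 0 :> L.
  by rewrite intrB intrM -Dn mulfV ?subrr.
rewrite intf_eq0 subr_eq0 => /eqP ln.
have : (l %| 1)%N by have := dvdz_mulr n (dvdzz l); rewrite ln dvdzE.
by rewrite dvdn1 => /eqP l1; rewrite l1 in pl.
Qed.

End QuadraticBase.

Lemma ramification_index_1 (L : splittingFieldType rat) (iota : {rmorphism L -> algC})
    (K : {subfield L}) (P : L -> Prop) (c : {rmorphism L -> L}) :
    nonzero_prime_ideal P ->
    (forall z, z \in K -> c z \in K) ->
    (forall z, z \in K -> z + c z \in 1%VS) -> (forall z, z \in K -> z * c z \in 1%VS) ->
    (forall g, g \in 'Gal({:L} / K)%g -> g != 1%g ->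
       exists2 th, ring_of_integers th & ~ P (g th - th)) ->
  ramification_index K P 1.
Proof.
move=> Pp cK ctr cnorm sep; split; last first.
  move=> ram; have [m [Om Km nPm sq]] := square_ideal_descends (galois_rat K) Pp sep ram.
  exact: (square_ideal_proper iota Pp cK ctr cnorm Om Km nPm sq).
apply: ideal_mul_ind => [|x y|a b [Pa _] Ob]; [exact: ideal_mul0 | exact: ideal_mulD | ].
exact: ideal_mul_incl.
Qed.

Section Congruence.

Variables (L : splittingFieldType rat) (P : L -> Prop).
Hypothesis Pp : nonzero_prime_ideal P.
Local Notation O := (@ring_of_integers L).

Let P0 : P 0. Proof. by case: Pp => [[]]. Qed.
Let PD x y : P x -> P y -> P (x + y). Proof. by case: Pp => [[]] _ _ + _ _ _ _; apply. Qed.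
Let PM a x : O a -> P x -> P (a * x). Proof. by case: Pp => [[]] _ _ _ + _ _ _; apply. Qed.
Let PN x : P x -> P (- x). Proof. by rewrite -mulN1r; apply: PM; apply/integersN/integers1. Qed.

(** Comparing coefficients with those of (X - y)^n replaces reduction to the residue field. *)
Lemma coef_prod_congr (y : L) (bs : seq L) : O y ->
    (forall b, b \in bs -> O b /\ P (b - y)) ->
  forall k, O (\prod_(b <- bs) ('X - b%:P))`_k /\
    P ((\prod_(b <- bs) ('X - b%:P))`_k - (('X - y%:P) ^+ size bs)`_k).
Proof.
move=> Oy; elim: bs => [|b bs IHbs] bsP k.
  rewrite big_nil expr0 subrr coef1; split=> //.
  by case: eqP => _; [apply: integers1 | apply: integers0].
have [Ob Pby] := bsP b (mem_head _ _).
have {}IHbs := IHbs (fun b' h => bsP b' (mem_behead (s := b :: bs) h)).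
rewrite big_cons exprS !mulrBl !coefB !coefXM !coefCM.
set p := \prod_(_ <- _) _ in IHbs *; set q := _ ^+ _ in IHbs *.
have [Opk Ppqk] := IHbs k.
have [Opk' Ppqk'] : O (if k == 0%N then 0 else p`_k.-1) /\
    P ((if k == 0%N then 0 else p`_k.-1) - (if k == 0%N then 0 else q`_k.-1)).
  by case: eqP => _; [rewrite subrr; split=> //; apply: integers0 | apply: IHbs].
split; first by apply: integersB => //; apply: integersM.
set a := if _ then _ else _ in Opk' Ppqk' *; set a' := if _ then _ else _ in Ppqk' *.
rewrite (_ : _ - _ = (a - a') - (p`_k * (b - y) + y * (p`_k - q`_k))); last by ring.
by apply: PD => //; apply/PN/PD; apply: PM.
Qed.

(* The roots of this quintic are not all congruent modulo any prime ideal: the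
   coefficients of X^4, X^3 and X would otherwise force 1 to lie in the ideal. *)
Lemma quintic_roots_incongruent (y : L) (j : int) (bs : seq L) : O y ->
    size bs = 5%N -> 'X^5 + 2%:P * 'X^4 + 2%:P * 'X^3 + (2 - 5 * j%:~R)%:P * 'X^2
      + (1 - 4 * j%:~R)%:P * 'X + (j%:~R - 5 * j%:~R ^+ 2)%:P
    = \prod_(b <- bs) ('X - b%:P) ->
  ~ (forall b, b \in bs -> O b /\ P (b - y)).
Proof.
move=> Oy sz; set f := LHS => ef bsP.
have := coef_prod_congr Oy bsP; rewrite -ef sz.
have -> : ('X - y%:P) ^+ 5 = 'X^5 - (5 * y)%:P * 'X^4 + (10 * y ^+ 2)%:P * 'X^3
    - (10 * y ^+ 3)%:P * 'X^2 + (5 * y ^+ 4)%:P * 'X - (y ^+ 5)%:P.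
  by rewrite !(polyCM, rmorphXn) /=; ring.
move=> co; have [_] := co 4%N; have [_] := co 3%N; have [_] := co 1%N.
rewrite /f !(coefD, coefN, coefCM, coefXn, coefX, coefC) /=.
rewrite !(mulr0, mulr1, add0r, addr0, subr0, sub0r, opprK, oppr0) => P1 P3 P4.
have OI' n : O n%:R := integers_int L n%:Z.
have P2 : P 2.
  (* 2 is a combination of the conditions from X^3 and X^4. With it y lies in P, and the condition
     from X reduces to 1. *)
  rewrite (_ : 2 = 5 * (2 - 10 * y ^+ 2) - (4 - 10 * y) * (2 + 5 * y)); last by ring.
  apply: PD; first exact: PM.
  by apply/PN/PM => //; apply: integersB => //; apply: integersM.
have Py : P y.
  rewrite (_ : y = (2 + 5 * y) - (1 + 2 * y) * 2); last by ring.
  apply: PD => //; apply/PN/PM => //; apply: integersD; first exact: integers1.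
  by apply: integersM.
case: Pp => _ _ + _; apply.
rewrite (_ : 1 = (1 - 4 * j%:~R - 5 * y ^+ 4) + (2 * j%:~R * 2 + 5 * y ^+ 3 * y)); last by ring.
apply: PD => //; apply: PD; apply: PM => //; apply: integersM => //; first exact: integers_int.
exact: integersX.
Qed.

End Congruence.

(** * Factorization of the quintic over the field of one root *)

Lemma quartic_expand (R : comNzRingType) (X a a' c c' : R) :
  (X ^+ 2 - a * X + c) * (X ^+ 2 - a' * X + c') = X ^+ 4 - (a + a') * X ^+ 3
  + (c + c' + a * a') * X ^+ 2 - (a * c' + a' * c) * X + c * c'.
Proof. by ring. Qed.

Lemma quintic_expand (R : comNzRingType) (X x a b c : R) :
  X ^+ 5 + a * X ^+ 3 - b * X ^+ 2 - c * X - x * (x ^+ 4 + a * x ^+ 2 - b * x - c)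
  = (X - x) * (X ^+ 4 + x * X ^+ 3 + (x ^+ 2 + a) * X ^+ 2
  + (x ^+ 3 + a * x - b) * X + (x ^+ 4 + a * x ^+ 2 - b * x - c)).
Proof. by ring. Qed.

Lemma poly_quintic_factor (R : comNzRingType) (x A A' C C' a b c e : R) :
    A + A' = - x -> C + C' + A * A' = x ^+ 2 + a ->
    A * C' + A' * C = - (x ^+ 3 + a * x - b) ->
    C * C' = x ^+ 4 + a * x ^+ 2 - b * x - c ->
    e = - (x * (x ^+ 4 + a * x ^+ 2 - b * x - c)) ->
  'X^5 + a%:P * 'X^3 - b%:P * 'X^2 - c%:P * 'X + e%:P
  = ('X - x%:P) * (('X^2 - A%:P * 'X + C%:P) * ('X^2 - A'%:P * 'X + C'%:P)).
Proof.
move=> e1 e2 e3 e4 ->; rewrite quartic_expand -!polyCM -!polyCD e1 e2 e3 e4.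
by rewrite !(polyCN, polyCB, polyCD, polyCM, rmorphXn) /= quintic_expand !mulNr !opprK.
Qed.

Section QuarticFactor.

Variables (F : fieldType) (x t : F).
Hypothesis (two : 2 != 0 :> F).

Let four : 4 != 0 :> F.
Proof. by rewrite (_ : 4 = 2 * 2) ?mulf_neq0 //; ring. Qed.

Definition qf := x ^+ 5 + 10 * x ^+ 3 - 5 * t * x ^+ 2 - 15 * x - t ^+ 2 + t - 16.
Definition qm := x ^+ 4 + 6 * x ^+ 2 - 2 * t * x - 3.
(** The two pairs of roots have sums differing by s [qn] / [qm] and products differing by - s [qe] /
    [qm]. The sum of the two products is [qg] / (t + 22), and [qd] / (t + 22) is the square of the
    difference of the sums. *)
Definition qn := x ^+ 2 - 4 * x + t + 1.
Definition qe := x ^+ 3 + 2 * x ^+ 2 + 5 * x + 2 - t.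
Definition qd := - 20 * x ^+ 4 + 60 * x ^+ 3 + (5 * t - 270) * x ^+ 2 + (80 * t + 700) * x
  - (180 * t + 480).
Definition qg := - 5 * x ^+ 4 + 15 * x ^+ 3 + (2 * t - 51) * x ^+ 2 + (20 * t + 175) * x
  + 100 - 35 * t.

(* The Galois group lies in the affine group of F_5, so the four roots other than x
   form two pairs over Q(x, s), s^2 = 5 (t^2 + 16): qA s and qC s are the sum and the
   product of one pair, and changing the sign of s gives the other one. The
   difference of the two sums is computed from Lagrange interpolation of
   f'(x) qA s, whence the denominator qm = f'(x) / 5. *)
Definition qA s := (- x + s * (qn / qm)) / 2.
Definition qC s := (qg / (t + 22) - s * (qe / qm)) / 2.

Hypothesis fx : qf = 0.

(** The cofactors write (t^2 + 16) (t + 22)^2 as a combination of f(x) and f'(x) / 5, so x is a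
    simple root. *)
Lemma qm_neq0 : t ^+ 2 + 16 != 0 -> t + 22 != 0 -> qm != 0.
Proof.
move=> t16 t22; have : (t ^+ 2 + 16) * (t + 22) ^+ 2 != 0 by rewrite mulf_neq0 // expf_neq0.
apply: contraNneq => m0; apply/eqP.
transitivity ((- 50 * x ^+ 4 + (84 - 3 * t) * x ^+ 3 + (18 * t - 554) * x ^+ 2
   + (t ^+ 2 + 183 * t + 892) * x + (9 * t ^+ 2 - 180 * t + 384)) * qm
  - (- 50 * x ^+ 3 + (84 - 3 * t) * x ^+ 2 + (18 * t - 354) * x
   + (t ^+ 2 + 45 * t + 556)) * qf); first by rewrite /qm /qf; ring.
by rewrite m0 fx !mulr0 subr0.
Qed.

Hypotheses (m0 : qm != 0) (t22 : t + 22 != 0).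
Variable s : F.
Hypothesis s2 : s ^+ 2 = 5 * (t ^+ 2 + 16).

Let N := s * (qn / qm).
Let E := s * (qe / qm).

(** The coefficients of the product of the two quadratics involve s only through N^2, N E and E^2,
    hence through s^2. With denominators cleared, each of these three values is an identity modulo
    [qf]; the long factor is the quotient by [qf]. *)
Lemma quartic_N2 : N ^+ 2 = qd / (t + 22).
Proof.
apply: (@mulfI _ (qm ^+ 2 * (t + 22))); first by rewrite mulf_neq0 ?expf_neq0.
transitivity (s ^+ 2 * (t + 22) * qn ^+ 2); first by rewrite /N; field; rewrite ?two ?four ?t22 ?m0.
transitivity (qm ^+ 2 * qd); last by field; rewrite ?two ?four ?t22 ?m0.
apply/eqP; rewrite -subr_eq0 s2; apply/eqP; transitivity (qf * (
      20 * x ^+ 7 - 60 * x ^+ 6 - 5 * x ^+ 5 * t + 310 * x ^+ 5 - 60 * x ^+ 4 * t - 820 *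
      x ^+ 4 + 110 * x ^+ 3 * t + (15 * 100 + 20) * x ^+ 3 + 15 * x ^+ 2 * t ^+ 2 - 390 *
      x ^+ 2 * t - (25 * 100 + 80) * x ^+ 2 + 40 * x * t ^+ 2 + (10 * 100 + 35) * x * t +
      (16 * 100 + 30) * x - 5 * t ^+ 3 - 125 * t ^+ 2 - 350 * t - 380
  )); first by rewrite /qm /qf /qn /qd; ring.
by rewrite fx mul0r.
Qed.

Let NE : N * E = x * (qg / (t + 22)) - 2 * (x ^+ 3 + 10 * x - 5 * t).
Proof.
apply: (@mulfI _ (qm ^+ 2 * (t + 22))); first by rewrite mulf_neq0 ?expf_neq0.
transitivity (s ^+ 2 * (t + 22) * qn * qe); first by rewrite /N /E; field; rewrite ?two ?four ?t22 ?m0.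
transitivity (qm ^+ 2 * (x * qg - 2 * (t + 22) * (x ^+ 3 + 10 * x - 5 * t))); last by field; rewrite ?two ?four ?t22 ?m0.
apply/eqP; rewrite -subr_eq0 s2; apply/eqP; transitivity (qf * (
      5 * x ^+ 8 - 15 * x ^+ 7 + 105 * x ^+ 6 - 15 * x ^+ 5 * t - 205 * x ^+ 5 + 40 * x ^+
      4 * t + 655 * x ^+ 4 - 5 * x ^+ 3 * t ^+ 2 - 290 * x ^+ 3 * t - 645 * x ^+ 3 + 10 *
      x ^+ 2 * t ^+ 2 + 310 * x ^+ 2 * t + (15 * 100 + 35) * x ^+ 2 - 45 * x * t ^+ 2 -
      975 * x * t + 345 * x + 5 * t ^+ 3 + 110 * t ^+ 2 - 10 * t - 220
  )); first by rewrite /qm /qf /qn /qe /qg; ring.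
by rewrite fx mul0r.
Qed.

Let E2 : E ^+ 2 = (qg / (t + 22)) ^+ 2 - 4 * (x ^+ 4 + 10 * x ^+ 2 - 5 * t * x - 15).
Proof.
apply: (@mulfI _ (qm ^+ 2 * (t + 22) ^+ 2)); first by rewrite mulf_neq0 ?expf_neq0.
transitivity (s ^+ 2 * (t + 22) ^+ 2 * qe ^+ 2); first by rewrite /E; field; rewrite ?two ?four ?t22 ?m0.
transitivity (qm ^+ 2 * (qg ^+ 2 - 4 * (t + 22) ^+ 2
   * (x ^+ 4 + 10 * x ^+ 2 - 5 * t * x - 15))); last by field; rewrite ?two ?four ?t22 ?m0.
apply/eqP; rewrite eq_sym -subr_eq0 s2; apply/eqP; transitivity (qf * (
      25 * x ^+ 11 - 150 * x ^+ 10 - 20 * x ^+ 9 * t + 785 * x ^+ 9 - 115 * x ^+ 8 * t -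
      (35 * 100 + 80) * x ^+ 8 + 380 * x ^+ 7 * t + (70 * 100 + 10) * x ^+ 7 + 85 * x ^+ 6
      * t ^+ 2 - (25 * 100 + 60) * x ^+ 6 * t - (247 * 100 + 60) * x ^+ 6 + 155 * x ^+ 5 *
      t ^+ 2 + (103 * 100 + 20) * x ^+ 5 * t + (204 * 100 + 70) * x ^+ 5 - 105 * x ^+ 4 *
      t ^+ 2 - (106 * 100 + 30) * x ^+ 4 * t - (297 * 100 + 40) * x ^+ 4 - 90 * x ^+ 3 * t
      ^+ 3 + (19 * 100 + 70) * x ^+ 3 * t ^+ 2 + (407 * 100 + 40) * x ^+ 3 * t + (162 *
      100 + 5) * x ^+ 3 - 45 * x ^+ 2 * t ^+ 3 - (71 * 100 + 65) * x ^+ 2 * t ^+ 2 + (64 *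
      100 + 20) * x ^+ 2 * t + ((12 * 100 + 93) * 100 + 90) * x ^+ 2 - 50 * x * t ^+ 3 -
      (22 * 100 + 25) * x * t ^+ 2 - (407 * 100) * x * t + (402 * 100 + 25) * x + 5 * t ^+
      4 + 205 * t ^+ 3 + (17 * 100 + 65) * t ^+ 2 - (71 * 100 + 15) * t - (122 * 100 + 80)
  )); first by rewrite /qm /qf /qe /qg; ring.
by rewrite fx mul0r.
Qed.

Lemma qAC_sum : qA s + qA (- s) = - x.
Proof. by rewrite /qA; field; rewrite ?two ?four ?t22 ?m0. Qed.

Lemma qAC_e2 : qC s + qC (- s) + qA s * qA (- s) = x ^+ 2 + 10.
Proof.
transitivity (qg / (t + 22) + (x ^+ 2 - N ^+ 2) / 4).
  by rewrite /qA /qC !mulNr -/N -/E; field; rewrite ?two ?four ?t22 ?m0.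
by rewrite quartic_N2 /qg /qd; field; rewrite ?two ?four ?t22 ?m0.
Qed.

Lemma qAC_e3 : qA s * qC (- s) + qA (- s) * qC s = - (x ^+ 3 + 10 * x - 5 * t).
Proof.
transitivity ((- x * (qg / (t + 22)) + N * E) / 2).
  by rewrite /qA /qC !mulNr -/N -/E; field; rewrite ?two ?four ?t22 ?m0.
by rewrite NE; field; rewrite ?two ?four ?t22 ?m0.
Qed.

Lemma qAC_e4 : qC s * qC (- s) = x ^+ 4 + 10 * x ^+ 2 - 5 * t * x - 15.
Proof.
transitivity (((qg / (t + 22)) ^+ 2 - E ^+ 2) / 4).
  by rewrite /qC !mulNr -/E; field; rewrite ?two ?four ?t22 ?m0.
by rewrite E2; field; rewrite ?two ?four ?t22 ?m0.
Qed.

Lemma quintic_factorization :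
  'X^5 + 10%:P * 'X^3 - (5 * t)%:P * 'X^2 - 15%:P * 'X + (- t ^+ 2 + t - 16)%:P
  = ('X - x%:P) * (('X^2 - (qA s)%:P * 'X + (qC s)%:P)
     * ('X^2 - (qA (- s))%:P * 'X + (qC (- s))%:P)).
Proof.
apply: (poly_quintic_factor qAC_sum qAC_e2 qAC_e3 qAC_e4).
by apply/eqP; rewrite -subr_eq0 -[X in _ == X]fx /qf; apply/eqP; ring.
Qed.

End QuarticFactor.

(** * The two discriminants when s = 10 (p^2 + q^2) *)

Section DihedralCase.

Variables (F : fieldType) (x p q a : F).
Hypotheses (two : 2 != 0 :> F).
Let t := 10 * (p * q) - 2.
Let four : 4 != 0 :> F.
Proof. by rewrite (_ : 4 = 2 * 2) ?mulf_neq0 //; ring. Qed.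
Let s := 10 * (p ^+ 2 + q ^+ 2).
Hypotheses (pq : q ^+ 2 - p * q - p ^+ 2 = - 1) (fx : qf x t = 0)
  (m0 : qm x t != 0) (t22 : t + 22 != 0) (a2 : 5 * a ^+ 2 = - (p ^+ 2 + q ^+ 2)).

Lemma dihedral_s2 : s ^+ 2 = 5 * (t ^+ 2 + 16).
Proof.
apply/eqP; rewrite -subr_eq0; apply/eqP.
transitivity (100 * (q ^+ 2 - p * q - p ^+ 2 + 1) * (q ^+ 2 - p ^+ 2 + p * q - 1)).
  by rewrite /s /t; ring.
by rewrite pq addNr mulr0 mul0r.
Qed.

(* The differences of the roots in the two pairs are 10 a qE1 / qm and
   10 a qE2 / qm, with 5 a^2 = - (p^2 + q^2). *)
Definition qE1 := 5 * p * x ^+ 2 - 10 * q * x + (2 * t - 1) * p + (t - 8) * q.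
Definition qE2 := 5 * q * x ^+ 2 + 10 * p * x + (2 * t - 1) * q - (t - 8) * p.

(** After clearing denominators and inserting N^2, the identity lies in the ideal generated by [qf]
    and q^2 - p q - p^2 + 1; the two long factors are its cofactors. *)
Lemma dihedral_disc1 : qA x t s ^+ 2 - 4 * qC x t s = - 20 * (p ^+ 2 + q ^+ 2) * (qE1 / qm x t) ^+ 2.
Proof.
set N := s * (qn x t / qm x t); have N2 : N ^+ 2 = qd x t / (t + 22) := quartic_N2 fx m0 t22 dihedral_s2.
apply: (@mulfI _ (4 * qm x t ^+ 2 * (t + 22))).
  by rewrite !mulf_neq0 ?expf_neq0 //.
transitivity (qm x t ^+ 2 * (t + 22) * (x ^+ 2 + N ^+ 2) - 8 * qm x t ^+ 2 * qg x t
  + 2 * (t + 22) * s * qm x t * (4 * qe x t - x * qn x t)).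
  by rewrite /qA /qC /N; field; rewrite ?two ?four ?t22 ?m0.
rewrite N2; transitivity (- (t + 22) * qm x t ^+ 2 * (5 * x ^+ 2 + 80) - qd x t * qm x t ^+ 2
  + 2 * (t + 22) * s * qm x t * (4 * qe x t - x * qn x t)).
  by rewrite /qg /qd; field; rewrite ?two ?four ?t22 ?m0.
transitivity (- (80 * (p ^+ 2 + q ^+ 2) * (t + 22) * qE1 ^+ 2)); last by field; rewrite ?two ?four ?t22 ?m0.
apply/eqP; rewrite -subr_eq0 opprK; apply/eqP; transitivity (qf x t * (
      20 * x ^+ 7 - 60 * x ^+ 6 - 100 * x ^+ 5 * p * q + 220 * x ^+ 5 - 600 * x ^+ 4 * p *
      q - 700 * x ^+ 4 + 200 * x ^+ 3 * p * q - 500 * x ^+ 3 + 600 * x ^+ 2 * p ^+ 3 * q +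
      (10 * 100) * x ^+ 2 * p ^+ 2 * q ^+ 2 + (12 * 100) * x ^+ 2 * p ^+ 2 + 600 * x ^+ 2
      * p * q ^+ 3 - (54 * 100) * x ^+ 2 * p * q + (12 * 100) * x ^+ 2 * q ^+ 2 - (15 *
      100 + 40) * x ^+ 2 + (24 * 100) * x * p ^+ 3 * q + (40 * 100) * x * p ^+ 2 * q ^+ 2
      + (48 * 100) * x * p ^+ 2 + (24 * 100) * x * p * q ^+ 3 + (59 * 100) * x * p * q +
      (48 * 100) * x * q ^+ 2 - (59 * 100 + 80) * x - (20 * 100) * p ^+ 4 * q ^+ 2 - (100
      * 100) * p ^+ 3 * q ^+ 3 - (22 * 100) * p ^+ 3 * q - (20 * 100) * p ^+ 2 * q ^+ 4 -
      (130 * 100) * p ^+ 2 * q ^+ 2 + (36 * 100) * p ^+ 2 - (22 * 100) * p * q ^+ 3 + (120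
      * 100) * p * q + (36 * 100) * q ^+ 2 - (39 * 100 + 40)
  ) + (q ^+ 2 - p * q - p ^+ 2 + 1) * (
      - (200 * 100) * x ^+ 4 * p ^+ 3 * q + (100 * 100) * x ^+ 4 * p ^+ 2 * q ^+ 2 - (400
      * 100) * x ^+ 4 * p ^+ 2 + (100 * 100) * x ^+ 4 * p * q - (200 * 100) * x ^+ 4 -
      ((16 * 100) * 100) * x ^+ 2 * p ^+ 4 * q ^+ 2 + (800 * 100) * x ^+ 2 * p ^+ 3 * q ^+
      3 - ((28 * 100) * 100) * x ^+ 2 * p ^+ 3 * q + ((10 * 100) * 100) * x ^+ 2 * p ^+ 2
      * q ^+ 2 + (800 * 100) * x ^+ 2 * p ^+ 2 + (800 * 100) * x ^+ 2 * p * q ^+ 3 - ((14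
      * 100) * 100) * x ^+ 2 * p * q + ((16 * 100) * 100) * x ^+ 2 * q ^+ 2 - (400 * 100)
      * x ^+ 2 - (800 * 100) * x * p ^+ 3 * q ^+ 3 - ((16 * 100) * 100) * x * p ^+ 2 * q
      ^+ 4 - ((16 * 100) * 100) * x * p * q ^+ 3 + ((24 * 100) * 100) * x * p * q + ((32 *
      100) * 100) * x * q ^+ 2 - ((16 * 100) * 100) * x - ((32 * 100) * 100) * p ^+ 5 * q
      ^+ 3 + ((20 * 100) * 100) * p ^+ 4 * q ^+ 4 - ((48 * 100) * 100) * p ^+ 4 * q ^+ 2 +
      (800 * 100) * p ^+ 3 * q ^+ 5 + (400 * 100) * p ^+ 3 * q ^+ 3 + ((30 * 100) * 100) *
      p ^+ 3 * q - ((51 * 100) * 100) * p ^+ 2 * q ^+ 2 - (400 * 100) * p ^+ 2 - ((24 *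
      100) * 100) * p * q ^+ 3 + ((37 * 100) * 100) * p * q + ((16 * 100) * 100) * q ^+ 2
      - ((10 * 100) * 100)
  )); first by rewrite /qm /qf /qn /qe /qd /qE1 /s /t; ring.
by rewrite fx pq addNr !mul0r addr0.
Qed.

Lemma dihedral_disc2 : qA x t (- s) ^+ 2 - 4 * qC x t (- s) = - 20 * (p ^+ 2 + q ^+ 2) * (qE2 / qm x t) ^+ 2.
Proof.
set N := s * (qn x t / qm x t); have N2 : N ^+ 2 = qd x t / (t + 22) := quartic_N2 fx m0 t22 dihedral_s2.
apply: (@mulfI _ (4 * qm x t ^+ 2 * (t + 22))).
  by rewrite !mulf_neq0 ?expf_neq0 //.
transitivity (qm x t ^+ 2 * (t + 22) * (x ^+ 2 + N ^+ 2) - 8 * qm x t ^+ 2 * qg x t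
  - 2 * (t + 22) * s * qm x t * (4 * qe x t - x * qn x t)).
  by rewrite /qA /qC /N; field; rewrite ?two ?four ?t22 ?m0.
rewrite N2; transitivity (- (t + 22) * qm x t ^+ 2 * (5 * x ^+ 2 + 80) - qd x t * qm x t ^+ 2
  - 2 * (t + 22) * s * qm x t * (4 * qe x t - x * qn x t)).
  by rewrite /qg /qd; field; rewrite ?two ?four ?t22 ?m0.
transitivity (- (80 * (p ^+ 2 + q ^+ 2) * (t + 22) * qE2 ^+ 2)); last by field; rewrite ?two ?four ?t22 ?m0.
apply/eqP; rewrite -subr_eq0 opprK; apply/eqP; transitivity (qf x t * (
      20 * x ^+ 7 - 60 * x ^+ 6 - 100 * x ^+ 5 * p * q + 220 * x ^+ 5 - 600 * x ^+ 4 * p *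
      q - 700 * x ^+ 4 + 200 * x ^+ 3 * p * q - 500 * x ^+ 3 - 600 * x ^+ 2 * p ^+ 3 * q +
      (10 * 100) * x ^+ 2 * p ^+ 2 * q ^+ 2 - (12 * 100) * x ^+ 2 * p ^+ 2 - 600 * x ^+ 2
      * p * q ^+ 3 - (54 * 100) * x ^+ 2 * p * q - (12 * 100) * x ^+ 2 * q ^+ 2 - (15 *
      100 + 40) * x ^+ 2 - (24 * 100) * x * p ^+ 3 * q + (40 * 100) * x * p ^+ 2 * q ^+ 2
      - (48 * 100) * x * p ^+ 2 - (24 * 100) * x * p * q ^+ 3 + (59 * 100) * x * p * q -
      (48 * 100) * x * q ^+ 2 - (59 * 100 + 80) * x + (20 * 100) * p ^+ 4 * q ^+ 2 - (100
      * 100) * p ^+ 3 * q ^+ 3 + (22 * 100) * p ^+ 3 * q + (20 * 100) * p ^+ 2 * q ^+ 4 -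
      (130 * 100) * p ^+ 2 * q ^+ 2 - (36 * 100) * p ^+ 2 + (22 * 100) * p * q ^+ 3 + (120
      * 100) * p * q - (36 * 100) * q ^+ 2 - (39 * 100 + 40)
  ) + (q ^+ 2 - p * q - p ^+ 2 + 1) * (
      (100 * 100) * x ^+ 4 * p ^+ 2 * q ^+ 2 + (200 * 100) * x ^+ 4 * p * q ^+ 3 + (100 *
      100) * x ^+ 4 * p * q + (400 * 100) * x ^+ 4 * q ^+ 2 - (200 * 100) * x ^+ 4 + (800
      * 100) * x ^+ 2 * p ^+ 3 * q ^+ 3 - (800 * 100) * x ^+ 2 * p ^+ 3 * q + ((16 * 100)
      * 100) * x ^+ 2 * p ^+ 2 * q ^+ 4 + ((10 * 100) * 100) * x ^+ 2 * p ^+ 2 * q ^+ 2 -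
      ((16 * 100) * 100) * x ^+ 2 * p ^+ 2 + ((28 * 100) * 100) * x ^+ 2 * p * q ^+ 3 -
      ((14 * 100) * 100) * x ^+ 2 * p * q - (800 * 100) * x ^+ 2 * q ^+ 2 - (400 * 100) *
      x ^+ 2 + ((16 * 100) * 100) * x * p ^+ 4 * q ^+ 2 - (800 * 100) * x * p ^+ 3 * q ^+
      3 + ((16 * 100) * 100) * x * p ^+ 3 * q - ((32 * 100) * 100) * x * p ^+ 2 + ((24 *
      100) * 100) * x * p * q - ((16 * 100) * 100) * x - (800 * 100) * p ^+ 5 * q ^+ 3 +
      ((20 * 100) * 100) * p ^+ 4 * q ^+ 4 + ((32 * 100) * 100) * p ^+ 3 * q ^+ 5 + (400 *
      100) * p ^+ 3 * q ^+ 3 + ((24 * 100) * 100) * p ^+ 3 * q + ((48 * 100) * 100) * p ^+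
      2 * q ^+ 4 - ((51 * 100) * 100) * p ^+ 2 * q ^+ 2 - ((16 * 100) * 100) * p ^+ 2 -
      ((30 * 100) * 100) * p * q ^+ 3 + ((37 * 100) * 100) * p * q + (400 * 100) * q ^+ 2
      - ((10 * 100) * 100)
  )); first by rewrite /qm /qf /qn /qe /qd /qE2 /s /t; ring.
by rewrite fx pq addNr !mul0r addr0.
Qed.

End DihedralCase.

Lemma size_quintic (R : nzRingType) (a b c d : R) :
  size ('X^5 + a%:P * 'X^3 - b%:P * 'X^2 - c%:P * 'X + d%:P : {poly R}) = 6%N
  /\ 'X^5 + a%:P * 'X^3 - b%:P * 'X^2 - c%:P * 'X + d%:P \is monic.
Proof.
have sz n (e : R) : (n <= 3)%N -> leq (size (e%:P * 'X^n)) 5.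
  move=> n3; rewrite mul_polyC; apply: leq_trans (size_scale_leq _ _) _.
  by rewrite size_polyXn; lia.
have szl : leq (size (a%:P * 'X^3 - b%:P * 'X^2 - c%:P * 'X + d%:P)) 5.
  apply: leq_trans (size_polyD _ _) _; rewrite geq_max (leq_trans (size_polyC_leq1 _)) ?andbT //.
  apply: leq_trans (size_polyD _ _) _; rewrite geq_max size_polyN (sz 1%N) ?andbT //.
  by apply: leq_trans (size_polyD _ _) _; rewrite geq_max size_polyN !sz.
rewrite -!addrA; move: szl; rewrite -!addrA; set q := (X in size X) => szl.
split; first by rewrite size_polyDl size_polyXn.
by rewrite monicE lead_coefDl ?lead_coefXn // size_polyXn.
Qed.

Lemma quintic_monic (t : int) : size (quintic t) = 6%N /\ quintic t \is monic.
Proof. exact: size_quintic. Qed.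

Lemma map_quintic_gen (R S : nzRingType) (f : {rmorphism R -> S}) (a b c d : R) :
  map_poly f ('X^5 + a%:P * 'X^3 - b%:P * 'X^2 - c%:P * 'X + d%:P)
  = 'X^5 + (f a)%:P * 'X^3 - (f b)%:P * 'X^2 - (f c)%:P * 'X + (f d)%:P.
Proof.
rewrite !mul_polyC rmorphD /= rmorphB /= rmorphB /= rmorphD /= !map_polyZ !map_polyXn.
by rewrite map_polyX map_polyC.
Qed.

Lemma map_quintic (F : fieldType) (f : {rmorphism rat -> F}) (t : int) :
  map_poly f (quintic t) = 'X^5 + 10%:P * 'X^3 - (5 * t%:~R)%:P * 'X^2 - 15%:P * 'X
    + (- t%:~R ^+ 2 + t%:~R - 16)%:P.
Proof.
rewrite /quintic map_quintic_gen rmorphM !rmorph_nat rmorph_int.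
by rewrite [f (_ - 16)]rmorphB [f (_ + _)]rmorphD [f (- _)]rmorphN rmorphXn rmorph_nat rmorph_int.
Qed.

Lemma horner_quintic (F : fieldType) (x t : F) :
  ('X^5 + 10%:P * 'X^3 - (5 * t)%:P * 'X^2 - 15%:P * 'X + (- t ^+ 2 + t - 16)%:P).[x]
  = qf x t.
Proof. by rewrite !(hornerE, hornerXn) /= /qf; ring. Qed.

Lemma horner_deriv_quintic (F : fieldType) (x t : F) :
  ('X^5 + 10%:P * 'X^3 - (5 * t)%:P * 'X^2 - 15%:P * 'X + (- t ^+ 2 + t - 16)%:P)^`().[x]
  = 5 * qm x t.
Proof.
rewrite !(derivE, derivM, derivXn) /= /qm.
rewrite !(hornerE, hornerXn, hornerMn) /=; ring.
Qed.

Lemma irreducible_no_root (F : fieldType) (f : {poly F}) (r : F) :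
  irreducible_poly f -> (2 < size f)%N -> ~~ root f r.
Proof.
move=> [_ irr] szf; apply/negP; rewrite -dvdp_XsubCl => /irr; rewrite size_XsubC => /(_ isT).
by move=> /eqp_size; rewrite size_XsubC => e; rewrite -e in szf.
Qed.

(** f_{-22} has the root 2. This keeps the denominators t + 22 nonzero. *)
Lemma irreducible_quintic_neq (t : int) : irreducible_poly (quintic t) -> t != -22.
Proof.
move=> irr; have [sz _] := quintic_monic t.
have := @irreducible_no_root _ _ 2 irr; rewrite sz => /(_ isT); apply: contraNneq => ->.
have <- : map_poly idfun (quintic (-22)) = quintic (-22) by apply: map_poly_id.
by rewrite /root (map_quintic idfun) horner_quintic.
Qed.

Lemma irreducible_adjoin_degree (F : fieldType) (L : fieldExtType F) (f : {poly F}) (x : L) :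
  irreducible_poly f -> root (map_poly (in_alg L) f) x -> adjoin_degree 1 x = (size f).-1.
Proof.
move=> [f1 irr] fx.
have /polyOver1P[q Dq] := minPolyOver 1 x.
have qf' : q %| f.
  rewrite -(dvdp_map (in_alg L)) -Dq minPoly_dvdp //.
  by apply/polyOver1P; exists f.
have szq : size q = (adjoin_degree 1 x).+1.
  by rewrite -(size_minPoly 1 x) Dq size_map_poly.
have /eqp_size <- : q %= f.
  by apply: irr qf'; rewrite szq.
by rewrite szq.
Qed.

Section Dihedral.

Variables (L : splittingFieldType rat) (p q t : int).
Hypotheses (Hpq : q ^+ 2 - p * q - p ^+ 2 = -1) (Ht : t = 10 * (p * q) - 2)
  (irr : irreducible_poly (quintic t)) (split : is_splitting_field (quintic t) L).

Let f : {poly L} := map_poly (in_alg L) (quintic t).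
Let P : L := p%:~R.
Let Q : L := q%:~R.
Let T : L := 10 * (P * Q) - 2.

Let two : 2 != 0 :> L. Proof. by rewrite natf_eq0. Qed.

Let tE : t%:~R = T :> L.
Proof. by rewrite Ht intrB !intrM. Qed.

Let PQ : Q ^+ 2 - P * Q - P ^+ 2 = -1.
Proof.
by transitivity ((q ^+ 2 - p * q - p ^+ 2)%:~R : L);
  [rewrite !expr2 !intrB !intrM | rewrite Hpq].
Qed.

Let T22 : T + 22 != 0.
Proof.
rewrite -tE (_ : _ + _ = (t + 22)%:~R); last by rewrite intrD.
by rewrite intf_eq0 addr_eq0 irreducible_quintic_neq.
Qed.

Let T16 : T ^+ 2 + 16 != 0.
Proof.
rewrite -tE (_ : _ + _ = (t ^+ 2 + 16)%:~R); last by rewrite intrD !expr2 intrM.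
by rewrite intf_eq0; have := sqr_ge0 t; move: (t ^+ 2) => u; clear; lia.
Qed.

Let fE : f = 'X^5 + 10%:P * 'X^3 - (5 * T)%:P * 'X^2 - 15%:P * 'X
    + (- T ^+ 2 + T - 16)%:P.
Proof. by rewrite /f map_quintic tE. Qed.

Lemma quintic_rootP x : root f x -> qf x T = 0.
Proof. by rewrite /root fE horner_quintic => /eqP. Qed.

Let m_neq0 x : root f x -> qm x T != 0.
Proof. by move/quintic_rootP => fx; apply: qm_neq0. Qed.

Let s : L := 10 * (P ^+ 2 + Q ^+ 2).
Let Q1 x : {poly L} := 'X^2 - (qA x T s)%:P * 'X + (qC x T s)%:P.
Let Q2 x : {poly L} := 'X^2 - (qA x T (- s))%:P * 'X + (qC x T (- s))%:P.

Let f_fact x : root f x -> f = ('X - x%:P) * (Q1 x * Q2 x).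
Proof.
move=> rx; have fx := quintic_rootP rx; have s2 := dihedral_s2 PQ.
by rewrite fE (quintic_factorization two fx (m_neq0 rx) T22 s2).
Qed.

Let split_roots : exists2 rs : seq L, f = \prod_(r <- rs) ('X - r%:P) & <<1 & rs>>%VS = fullv.
Proof.
have [rs frs gen] := split; exists rs => //; apply/eqP.
by rewrite -eqp_monic ?monic_prod_XsubC // map_monic; have [] := quintic_monic t.
Qed.

Lemma quintic_has_root : exists x : L, root f x.
Proof.
have [rs frs _] := split_roots; have [sz _] := quintic_monic t.
have : size f = 6%N by rewrite size_map_poly.
rewrite frs size_prod_XsubC; case: rs frs => // x rs frs _.
by exists x; rewrite root_prod_XsubC mem_head.
Qed.

Let Q1_root x : root f x -> exists r, root (Q1 x) r.
Proof.
move=> rx; have [rs frs _] := split_roots.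
have : Q1 x %| \prod_(r <- rs) ('X - r%:P).
  by rewrite -frs (f_fact rx) dvdp_mull // dvdp_mulr.
case/dvdp_prod_XsubC => m' Q1m.
have sz : size (Q1 x) = 3%N.
  rewrite /Q1 -addrA size_polyDl size_polyXn // ltnS.
  apply: leq_trans (size_polyD _ _) _; rewrite geq_max (leq_trans (size_polyC_leq1 _)) ?andbT //.
  by rewrite size_polyN mul_polyC (leq_trans (size_scale_leq _ _)) ?size_polyX.
have := eqp_size Q1m; rewrite sz size_prod_XsubC => szm.
case Dm : (mask m' rs) szm => [|r rs'] // _; exists r.
by rewrite (eqp_root Q1m) Dm root_prod_XsubC mem_head.
Qed.

Lemma quadratic_rootE (A C r : L) : root ('X^2 - A%:P * 'X + C%:P) r -> (2 * r - A) ^+ 2 = A ^+ 2 - 4 * C.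
Proof.
rewrite /root !(hornerE, hornerXn) /= => /eqP e; apply/eqP; rewrite -subr_eq0; apply/eqP.
by transitivity (4 * (r ^+ 2 - A * r + C)); [ring | rewrite e mulr0].
Qed.

(** If [qE1] vanished, so would the discriminant of [Q1], and its root would be a double root of f,
    against [qm] != 0. *)
Let qE1_neq0 x : root f x -> qE1 x P Q != 0.
Proof.
move=> rx; have [r rr] := Q1_root rx; have fx := quintic_rootP rx.
have frr : root f r by rewrite (f_fact rx) !rootM rr orbT.
apply: contraTneq (m_neq0 frr) => e0; apply/negPn/eqP.
have five : 5 != 0 :> L by rewrite natf_eq0.
apply: (mulfI five); rewrite mulr0 -horner_deriv_quintic -fE.
have disc := quadratic_rootE rr.
rewrite (dihedral_disc1 two PQ fx (m_neq0 rx) T22) in disc.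
rewrite e0 mul0r expr0n mulr0 in disc.
move/eqP: disc; rewrite sqrf_eq0 subr_eq0 => /eqP DA.
have DC : qC x T s = r ^+ 2.
  move: rr; rewrite /root !(hornerE, hornerXn) /= -DA => /eqP e.
  by apply/eqP; rewrite -subr_eq0 -[X in _ == X]e; apply/eqP; ring.
have -> : f = ('X - r%:P) ^+ 2 * (('X - x%:P) * Q2 x).
  rewrite (f_fact rx) /Q1 -DA DC polyCM rmorphXn /=; ring.
by rewrite derivM deriv_exp !(hornerE, hornerXn) /= subrr; ring.
Qed.

(** The difference of the roots of [Q1] squares to - 20 F (qE1 / qm)^2, with F = P^2 + Q^2; dividing
    it by 10 qE1 / qm gives a. *)
Lemma quintic_sqrt : exists a : L, 5 * a ^+ 2 = - (P ^+ 2 + Q ^+ 2).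
Proof.
have [x rx] := quintic_has_root.
have fx := quintic_rootP rx; have m0 := m_neq0 rx; have e0 := qE1_neq0 rx.
have [r /quadratic_rootE rr] := Q1_root rx.
rewrite (dihedral_disc1 two PQ fx m0 T22) in rr.
exists ((2 * r - qA x T s) * (qm x T / (10 * qE1 x P Q))).
have ten : 10 != 0 :> L by rewrite natf_eq0.
by rewrite exprMn rr; field; rewrite m0 e0 ten.
Qed.

Variable a : L.
Hypothesis a2 : 5 * a ^+ 2 = - (P ^+ 2 + Q ^+ 2).

(** Over Q(a, x) both discriminants are squares, namely of 10 a qE1 / qm and 10 a qE2 / qm. *)
Lemma quintic_splitting_adjoin x : root f x -> <<<<1; a>>; x>>%VS = fullv.
Proof.
move=> rx; have [rs frs gen] := split_roots; have fx := quintic_rootP rx; have m0 := m_neq0 rx.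
pose M := <<<<1; a>>; x>>%AS.
have Mx : x \in M by apply: memv_adjoin.
have Ma : a \in M by apply/subvP_adjoin/memv_adjoin.
have MI (n : int) : n%:~R \in M by apply: rpred_int.
have MN (n : nat) : n%:R \in M by apply: rpred_nat.
have M1 : 1 \in M := MN 1%N.
have MP : P \in M := MI p.
have MQ : Q \in M := MI q.
have MT : T \in M by rewrite -tE; apply: MI.
have MD u v : u \in M -> v \in M -> u + v \in M by apply: rpredD.
have MB u v : u \in M -> v \in M -> u - v \in M by apply: rpredB.
have MM u v : u \in M -> v \in M -> u * v \in M by apply: rpredM.
have MX u n : u \in M -> u ^+ n \in M by apply: rpredX.
have MV u : u \in M -> u^-1 \in M by rewrite rpredV.
have MO u : u \in M -> - u \in M by rewrite rpredN.
have Mm : qm x T \in M.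
  rewrite /qm;
  repeat first [exact: M1 | exact: MN | exact: MP | exact: MQ | exact: MT | exact: Mx
    | apply MD | apply MO | apply MM | apply MX].
have Mn : qn x T \in M.
  rewrite /qn;
  repeat first [exact: M1 | exact: MN | exact: MP | exact: MQ | exact: MT | exact: Mx
    | apply MD | apply MO | apply MM | apply MX].
have Ms : s \in M by rewrite /s;
  repeat first [exact: M1 | exact: MN | exact: MP | exact: MQ | exact: MT | exact: Mx
    | apply MD | apply MO | apply MM | apply MX].
have MA s' : s' \in M -> qA x T s' \in M.
  move=> Ms'; rewrite /qA; apply MM; last exact: MV.
  by apply MD; [apply MO | apply MM => //; apply MM => //; apply MV].
have Me1 : qE1 x P Q \in M by rewrite /qE1;
  repeat first [exact: M1 | exact: MN | exact: MP | exact: MQ | exact: MT | exact: Mx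
    | apply MD | apply MO | apply MM | apply MX].
have Me2 : qE2 x P Q \in M by rewrite /qE2;
  repeat first [exact: M1 | exact: MN | exact: MP | exact: MQ | exact: MT | exact: Mx
    | apply MD | apply MO | apply MM | apply MX].
have half A C e r : A \in M -> e \in M -> root ('X^2 - A%:P * 'X + C%:P) r ->
    A ^+ 2 - 4 * C = - 20 * (P ^+ 2 + Q ^+ 2) * (e / qm x T) ^+ 2 -> r \in M.
  move=> HA He /quadratic_rootE + disc; rewrite disc.
  have -> : - 20 * (P ^+ 2 + Q ^+ 2) * (e / qm x T) ^+ 2 = (10 * a * (e / qm x T)) ^+ 2.
    by rewrite -[- 20 * _]opprK -[- (- 20 * _)]mulrN -a2; ring.
  have Mb : 10 * a * (e / qm x T) \in M by apply MM; [apply MM | apply MM; last by apply MV].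
  move: (10 * a * _) Mb => b Mb /eqP; rewrite eqf_sqr => /orP[] /eqP e2.
    have -> : r = (A + b) / 2 by rewrite -e2; field.
    by apply MM; [apply MD | apply MV].
  have -> : r = (A - b) / 2 by rewrite -[b]opprK -e2; field.
  by apply MM; [apply MB | apply MV].
apply/eqP; rewrite eqEsubv subvf -gen; apply/Fadjoin_seqP; split; first exact: sub1v.
move=> r; rewrite -root_prod_XsubC -frs (f_fact rx) !rootM => /or3P[].
- by rewrite root_XsubC => /eqP->.
- by move=> hr; apply: (half _ _ _ _ (MA _ Ms) Me1 hr (dihedral_disc1 two PQ fx m0 T22)).
- move=> hr; apply: (half _ _ _ _ (MA _ (MO _ Ms)) Me2 hr).
  exact: (dihedral_disc2 two PQ fx m0 T22).
Qed.

End Dihedral.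

(** * Imaginary quadratic subfields *)

Section QuadraticSubfield.

Variables (L : splittingFieldType rat) (iota : {rmorphism L -> algC}) (a : L).
Hypotheses (a2Q : a ^+ 2 \in 1%VS) (a2neg : iota a ^+ 2 < 0).

Lemma imaginary_notin1 : a \notin 1%VS.
Proof.
apply/negP => /vlineP[r Da]; move: a2neg; rewrite Da alg_num_field fmorph_rat.
by rewrite -rmorphXn /= ltrq0 ltNge sqr_ge0.
Qed.

Lemma dim_imaginary : \dim <<1; a>> = 2%N.
Proof.
rewrite dim_Fadjoin dimv1 muln1; apply/eqP; rewrite eqn_leq; apply/andP; split; last first.
  by rewrite ltn_neqAle eq_sym adjoin_deg_eq1 imaginary_notin1.
rewrite -ltnS -size_minPoly.
have pz : 'X^2 - (a ^+ 2)%:P != 0 :> {poly L} by rewrite -size_poly_gt0 size_XnsubC.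
rewrite -[3%N](@size_XnsubC _ 2 (a ^+ 2)) //; apply: dvdp_leq => //.
apply: minPoly_dvdp; last by rewrite /root !(hornerE, hornerXn) subrr.
by rewrite rpredB ?polyOverXn ?polyOverC.
Qed.

Lemma imaginary_conj : exists c : gal_of {:L}, c a = - a.
Proof.
have galL : galois 1%AS {:L} := galois_rat 1%AS.
have : exists2 c, c \in 'Gal({:L} / 1%AS)%g & c a != a.
  apply/exists_inP; apply: contraNT imaginary_notin1; rewrite negb_exists_in => /forall_inP fix_a.
  move/galois_fixedField: galL => <-; apply/fixedFieldP; first exact: memvf.
  by move=> c /fix_a /negPn/eqP.
case=> c Gc ca; exists c; apply/eqP; move: ca; apply: contraR => cNa.
have : c a ^+ 2 == a ^+ 2 by rewrite -rmorphXn; apply/eqP; apply: fixed_gal (sub1v _) Gc a2Q.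
by rewrite eqf_sqr (negPf cNa) orbF.
Qed.

Lemma imaginary_decomp z : z \in <<1; a>>%VS ->
  exists u, exists v, [/\ u \in 1%VS, v \in 1%VS & z = u + v * a].
Proof.
move=> Kz; have sz := size_Fadjoin_poly 1 a z.
have := dim_imaginary; rewrite dim_Fadjoin dimv1 muln1 => deg; rewrite deg in sz.
exists (Fadjoin_poly 1 a z)`_0, (Fadjoin_poly 1 a z)`_1.
have /polyOverP over := Fadjoin_polyOver 1 a z; split; try exact: over.
rewrite -{1}(Fadjoin_poly_eq Kz) (horner_coef_wide _ sz) !big_ord_recl big_ord0 /=.
by rewrite expr0 mulr1 addr0 expr1.
Qed.

Lemma imaginary_ramification P :
    nonzero_prime_ideal P ->
    (forall g, g \in 'Gal({:L} / <<1; a>>%AS)%g -> g != 1%g ->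
       exists2 th, ring_of_integers th & ~ P (g th - th)) ->
  ramification_index <<1; a>>%AS P 1.
Proof.
move=> Pp; have [c ca] := imaginary_conj; pose c' : {rmorphism L -> L} := c.
have cE z : z \in <<1; a>>%VS -> exists u, exists v,
    [/\ u \in 1%VS, v \in 1%VS, z = u + v * a & c' z = u - v * a].
  move=> /imaginary_decomp[u [v [Qu Qv Dz]]]; exists u, v; split=> //.
  have c1 y : y \in 1%VS -> c y = y.
    by case/vlineP=> r ->; rewrite linearZ /= rmorph1.
  transitivity (c u + c v * c a); first by rewrite Dz rmorphD rmorphM.
  by rewrite ca !c1 // mulrN.
have Ka : a \in <<1; a>>%VS by apply: memv_adjoin.
have K1 y : y \in 1%VS -> y \in <<1; a>>%VS by apply/subvP/sub1v.
apply: (@ramification_index_1 L iota <<1; a>>%AS P c' Pp).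
- move=> z /cE[u [v [Qu Qv _ ->]]].
  by apply: rpredB; [apply: K1 | apply: rpredM => //; apply: K1].
- move=> z /cE[u [v [Qu Qv -> ->]]].
  by rewrite addrACA subrr addr0 rpredD.
- move=> z /cE[u [v [Qu Qv -> ->]]].
  have -> : (u + v * a) * (u - v * a) = u * u - v * v * a ^+ 2 by ring.
  by apply: rpredB; [apply: rpredM | apply: rpredM => //; apply: rpredM].
Qed.

(** a^2 is a negative rational, so no embedding is real on Q(a) and the condition at infinity is
    vacuous. *)
Lemma imaginary_unramified_infinite : unramified_infinite <<1; a>>%AS.
Proof.
move=> sigma realK; exfalso; have Ka : a \in <<1; a>>%VS by apply: memv_adjoin.
have := realK a Ka; rewrite realEsqr -rmorphXn.
have /vlineP[r Dr] := a2Q; move: a2neg.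
by rewrite -rmorphXn Dr alg_num_field !fmorph_rat ltrq0 ler0q ltNge => /negPf->.
Qed.

End QuadraticSubfield.

Lemma size_quintic4 (R : nzRingType) (a b c d e : R) :
  let h := 'X^5 + a%:P * 'X^4 + b%:P * 'X^3 + c%:P * 'X^2 + d%:P * 'X + e%:P in
  size h = 6%N /\ h \is monic.
Proof.
move=> h; pose k := a%:P * 'X^4 + b%:P * 'X^3 + c%:P * 'X^2 + d%:P * 'X + e%:P.
have hE : h = 'X^5 + k by rewrite /h /k !addrA.
have sz n (u : R) : (n <= 4)%N -> leq (size (u%:P * 'X^n)) 5.
  move=> n4; rewrite mul_polyC; apply: leq_trans (size_scale_leq _ _) _.
  by rewrite size_polyXn.
have szD (u v : {poly R}) : leq (size u) 5 -> leq (size v) 5 -> leq (size (u + v)) 5.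
  by move=> su sv; rewrite (leq_trans (size_polyD _ _)) // geq_max su.
have szk : leq (size k) 5.
  apply: (szD _ _ _ _); last by rewrite (leq_trans (size_polyC_leq1 _)).
  by rewrite szD ?(sz 1%N) // szD ?sz // szD ?sz.
rewrite hE; split; first by rewrite size_polyDl size_polyXn.
by rewrite monicE lead_coefDl ?lead_coefXn // size_polyXn.
Qed.

Lemma map_quintic4 (R S : nzRingType) (f : {rmorphism R -> S}) (a b c d e : R) :
  map_poly f ('X^5 + a%:P * 'X^4 + b%:P * 'X^3 + c%:P * 'X^2 + d%:P * 'X + e%:P)
  = 'X^5 + (f a)%:P * 'X^4 + (f b)%:P * 'X^3 + (f c)%:P * 'X^2 + (f d)%:P * 'X + (f e)%:P.
Proof.
rewrite !mul_polyC; do 5![rewrite rmorphD /=]; rewrite !map_polyZ !map_polyXn.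
by rewrite map_polyX map_polyC.
Qed.

(** * The splitting field over the field of the nested radical *)

Section UnramifiedCyclic.

Variables (L : splittingFieldType rat) (iota : {rmorphism L -> algC}) (p q t j : int).
Hypotheses (Hpq : q ^+ 2 - p * q - p ^+ 2 = -1) (Ht : t = 10 * (p * q) - 2)
  (Hj : t = -22 + 125 * j)
  (irr : irreducible_poly (quintic t)) (split : is_splitting_field (quintic t) L).

Let N : int := p ^+ 2 + q ^+ 2.

Let N_gt0 : 0 < N.
Proof.
rewrite lt0r addr_ge0 ?sqr_ge0 // andbT paddr_eq0 ?sqr_ge0 // !sqrf_eq0.
by apply/negP => /andP[/eqP p0 /eqP q0]; move: Hpq; rewrite p0 q0.
Qed.

(** t^2 + 16 = 20 N^2, so the inner square root is the rational number N / 5. *)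
Lemma nested_radical_sqr : nested_radical t ^+ 2 = - (N%:~R / 5).
Proof.
rewrite /nested_radical sqrtCK; congr (- _).
have -> : (t%:~R ^+ 2 + 16) / 500 = (N%:~R / 5 : algC) ^+ 2.
  have tN : t ^+ 2 + 16 = 20 * N ^+ 2.
    apply/eqP; rewrite -subr_eq0; apply/eqP.
    transitivity (- 20 * ((q ^+ 2 - p * q - p ^+ 2 + 1) * (q ^+ 2 - p ^+ 2 + p * q - 1))).
      by rewrite Ht /N; ring.
    by rewrite Hpq addNr mul0r mulr0.
  have -> : t%:~R ^+ 2 + 16 = 20 * N%:~R ^+ 2 :> algC.
    transitivity ((t ^+ 2 + 16)%:~R : algC); first by rewrite intrD !expr2 intrM.
    by rewrite tN !expr2 !intrM.
  by field.
by rewrite sqrCK // divr_ge0 // ler0z ltW.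
Qed.

Lemma quintic_nested_sqrt : exists a : L, iota a = nested_radical t
  /\ 5 * a ^+ 2 = - (p%:~R ^+ 2 + q%:~R ^+ 2).
Proof.
have [a0 a02] := quintic_sqrt Hpq Ht irr split.
have : iota a0 ^+ 2 = nested_radical t ^+ 2.
  have e : 5 * iota a0 ^+ 2 = - N%:~R.
    transitivity (iota (5 * a0 ^+ 2)); first by rewrite rmorphM rmorph_nat rmorphXn.
    by rewrite a02 rmorphN rmorphD !rmorphXn !rmorph_int /N intrD !expr2 !intrM.
  by rewrite nested_radical_sqr -mulNr -e; field.
move/eqP; rewrite eqf_sqr => /orP[]/eqP ia; first by exists a0.
by exists (- a0); split; [rewrite rmorphN ia opprK | rewrite sqrrN].
Qed.

Section WithGenerator.

Variable a : L.
Hypotheses (ia : iota a = nested_radical t) (a2 : 5 * a ^+ 2 = - (p%:~R ^+ 2 + q%:~R ^+ 2)).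

Let K := <<1; a>>%AS.

Let a2Q : a ^+ 2 \in 1%VS.
Proof.
have five : 5 != 0 :> L by rewrite natf_eq0.
rewrite -[a ^+ 2](mulKf five) a2; apply: rpredM; first by rewrite rpredV rpred_nat.
by rewrite rpredN rpredD // rpredX // rpred_int.
Qed.

Let a2neg : iota a ^+ 2 < 0.
Proof. by rewrite ia nested_radical_sqr oppr_lt0 divr_gt0 // ltr0z. Qed.

Let f : {poly L} := map_poly (in_alg L) (quintic t).

(** 5 divides [L : Q] = 2 [L : K], and [L : K] is at most 5 because x generates L over K. *)
Lemma quintic_adjoin_degree x : root f x -> adjoin_degree K x = 5%N.
Proof.
move=> fx; have gen := quintic_splitting_adjoin Hpq Ht irr split a2 fx.
have dK : \dim K = 2%N := dim_imaginary a2Q a2neg.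
have dL : \dim {:L} = (adjoin_degree K x * 2)%N by rewrite -gen dim_Fadjoin dK.
have [sz _] := quintic_monic t.
have d5 : (5 %| \dim {:L})%N.
  have := field_dimS (subvf <<1; x>>%AS).
  by rewrite dim_Fadjoin dimv1 muln1 (irreducible_adjoin_degree irr fx) sz.
have le5 : (adjoin_degree K x <= 5)%N.
  have szf : size f = 6%N by rewrite size_map_poly.
  rewrite -ltnS -size_minPoly -szf dvdp_leq -?size_poly_gt0 ?szf //.
  apply: minPoly_dvdp => //; apply: (polyOverS (subvP (sub1v K))).
  by apply/polyOver1P; exists (quintic t).
rewrite dL Gauss_dvdl // in d5; apply/eqP; rewrite eqn_leq le5 dvdn_leq //.
Qed.

Lemma card_quintic_gal : #|'Gal({:L} / K)%g| = 5%N.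
Proof.
have [x fx] := quintic_has_root split.
rewrite -(galois_dim (galois_rat K)) -(quintic_adjoin_degree fx) adjoin_degreeE.
by rewrite (quintic_splitting_adjoin Hpq Ht irr split a2 fx).
Qed.

Lemma quintic_minPoly x : root f x -> minPoly K x = f.
Proof.
move=> fx; have [sz mon] := quintic_monic t; apply/eqP.
rewrite -eqp_monic ?monic_minPoly // ?map_monic // -dvdp_size_eqp.
  by rewrite size_minPoly quintic_adjoin_degree // size_map_poly sz.
apply: minPoly_dvdp => //; apply: (polyOverS (subvP (sub1v K))).
by apply/polyOver1P; exists (quintic t).
Qed.

Lemma quintic_separates P : nonzero_prime_ideal P ->
  forall g, g \in 'Gal({:L} / K)%g -> g != 1%g ->
    exists2 th, ring_of_integers th & ~ P (g th - th).
Proof.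
move=> Pp g Gg g1; apply: NNPP => none.
have gP th : ring_of_integers th -> P (g th - th).
  by move=> Oth; apply: NNPP => nP; apply: none; exists th.
have P0 : P 0 by case: Pp => [[]].
have PD u v : P u -> P v -> P (u + v) by case: Pp => [[]] _ _ + _ _ _ _; apply.
(* The group has prime order, so g generates it and all of it acts trivially modulo P. *)
have gen : ('Gal({:L} / K) = <[g]>)%g.
  apply/eqP; rewrite eq_sym eqEcard cycle_subG Gg /= card_quintic_gal -orderE.
  have := order_dvdG Gg; rewrite card_quintic_gal.
  case/primeP: (isT : prime 5) => _ /[apply]; rewrite order_eq1 (negPf g1) /=.
  by move=> /eqP->.
have hP h th : h \in 'Gal({:L} / K)%g -> ring_of_integers th -> P (h th - th).
  rewrite gen => /cycleP[n ->] Oth; elim: n => [|n IHn].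
    by rewrite expg0 gal_id subrr.
  rewrite expgSr galM ?memvf // -[_ - th](subrKA ((g ^+ n)%g th)).
  by apply: PD => //; apply: gP; apply: integers_rmorph.
have [x fx] := quintic_has_root split.
have [sz _] := quintic_monic t.
have [r [rG ur fr]] := elimT (galois_factors (subvf K)) (galois_rat K) x (memvf x).
rewrite (quintic_minPoly fx) in fr.
pose y := (x - 2) / 5; have five : 5 != 0 :> L by rewrite natf_eq0.
have Dx : x = 5 * y + 2 by rewrite /y; field.
have fE : qf x t%:~R = 0.
  by have := fx; rewrite /root /f map_quintic horner_quintic => /eqP.
have TJ : t%:~R = - 22 + 125 * j%:~R :> L by rewrite Hj intrD intrM.
(* [hp] at j is f_t(5 Y + 2) / 5^5 for t = -22 + 125 j; its coefficients are integers. *)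
pose hp (R : comNzRingType) (k : R) : {poly R} := 'X^5 + 2%:P * 'X^4 + 2%:P * 'X^3
  + (2 - 5 * k)%:P * 'X^2 + (1 - 4 * k)%:P * 'X + (k - 5 * k ^+ 2)%:P.
have map_hp (R S : comNzRingType) (m : {rmorphism R -> S}) k : map_poly m (hp R k) = hp S (m k).
  rewrite /hp map_quintic4 !rmorph_nat; congr (_ + _%:P * _ + _%:P * _ + _%:P).
  - by rewrite rmorphB rmorphM !rmorph_nat.
  - by rewrite rmorphB rmorphM rmorph1 rmorph_nat.
  - by rewrite rmorphB rmorphM rmorphXn rmorph_nat.
have hy : root (hp L j%:~R) y.
  have c0 : 3125 != 0 :> L by rewrite natf_eq0.
  apply/eqP/(mulfI c0); rewrite mulr0 -fE TJ Dx /hp /qf.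
  by rewrite !(hornerD, hornerM, hornerC, hornerXn, hornerX); ring.
have Oy : ring_of_integers y.
  exists (hp _ j); first exact: (size_quintic4 _ _ _ _ _).2.
  by rewrite (map_hp _ _ intr).
have szr : size [seq c y | c : gal_of {:L} <- r] = 5%N.
  apply: succn_inj; rewrite size_map -(size_map (fun c : gal_of {:L} => c x)).
  by rewrite -(size_prod_XsubC _ id) -fr size_map_poly.
have h_prod : hp L j%:~R = \prod_(b <- [seq c y | c : gal_of {:L} <- r]) ('X - b%:P).
  have [szh monh] : size (hp L j%:~R) = 6%N /\ hp L j%:~R \is monic by apply: size_quintic4.
  rewrite [LHS](@all_roots_prod_XsubC _ _ [seq c y | c : gal_of {:L} <- r]).
  - by rewrite (monicP monh) scale1r.
  - by rewrite szr szh.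
  - apply/allP => b /mapP[c _ ->]; have := rmorph_root c hy.
    by rewrite map_hp rmorph_int.
  rewrite uniq_rootsE; apply: (@map_uniq _ _ (fun z => 5 * z + 2)); rewrite -map_comp.
  move: ur; congr (uniq _); apply: eq_map => c /=.
  by rewrite {1}Dx rmorphD rmorphM !rmorph_nat.
apply: (quintic_roots_incongruent Pp Oy szr h_prod) => b /mapP[c rc ->].
by split; [apply: integers_rmorph | apply: hP => //; apply: (subsetP rG)].
Qed.

Lemma quintic_unramified_cyclic : unramified_cyclic K.
Proof.
split; first exact: galois_rat.
  by rewrite prime_cyclic // card_quintic_gal.
split; last exact: imaginary_unramified_infinite a2Q a2neg.
move=> P Pp; apply: (imaginary_ramification a2Q a2neg Pp).
exact: quintic_separates.
Qed.

Lemma quintic_dim_base : \dim <<1; a>> = 2%N.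
Proof. exact: dim_imaginary a2Q a2neg. Qed.

End WithGenerator.

Lemma quintic_quadratic_unramified : exists a : L, quadratic_unramified_cyclic t iota a.
Proof.
have [a [ia a2]] := quintic_nested_sqrt; exists a; split=> //.
  exact: quintic_dim_base ia a2.
exact: quintic_unramified_cyclic ia a2.
Qed.

End UnramifiedCyclic.

(** * Lucas numbers of index 20 i - 5 *)

Lemma lucas_rec2 (n : int) : lucas (n + 2) = lucas (n + 1) + lucas n.
Proof. by rewrite (lucas_rec (n + 2)); congr (lucas _ + lucas _); lia. Qed.

(* With n = 2 k + 1, the pair (p, q) is (F_k, F_{k+1}). *)
Definition lucas_fib (n p q : int) :=
  lucas n = 4 * (p * q) + q ^+ 2 - p ^+ 2 /\
  lucas (n + 1) = 2 * p ^+ 2 + 3 * q ^+ 2 + 2 * (p * q).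

Lemma lucas_fib_next n p q : lucas_fib n p q -> lucas_fib (n + 2) q (p + q).
Proof.
case=> e1 e2; have e3 := lucas_rec2 n; rewrite e1 e2 in e3.
split; first by rewrite e3; ring.
by rewrite -addrA (addrC 2) addrA lucas_rec2 -addrA -[1 + 1]/2 e3 e2; ring.
Qed.

Lemma lucas_fib_prev n p q : lucas_fib n p q -> lucas_fib (n - 2) (q - p) p.
Proof.
case=> e1 e2; have := lucas_rec2 (n - 1); have := lucas_rec2 (n - 2).
rewrite subrK (_ : n - 2 + 1 = n - 1); last by lia.
rewrite (_ : n - 1 + 2 = n + 1); last by lia.
rewrite subrK e1 e2 => e3 e4.
have e5 : lucas (n - 1) = 3 * p ^+ 2 + 2 * q ^+ 2 - 2 * (p * q).
  by apply: (@addrI _ (4 * (p * q) + q ^+ 2 - p ^+ 2)); rewrite -e4; ring.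
rewrite e5 in e3; rewrite /lucas_fib (_ : n - 2 + 1 = n - 1); last by lia.
split; last by rewrite e5; ring.
by apply: (@addrI _ (3 * p ^+ 2 + 2 * q ^+ 2 - 2 * (p * q))); rewrite -e3; ring.
Qed.

(** Passing from i to i + 1 changes p q by 55 (34 p^2 + 110 p q + 89 q^2), where the form is
    divisible by 5 once p = - 2 q mod 5; this carries 25 | p q + 2 along. *)
Definition dihedral_index (i p q : int) :=
  [/\ lucas_fib (20 * i - 5) p q, q ^+ 2 - p * q - p ^+ 2 = -1,
      (5 %| p + 2 * q)%Z & (25 %| p * q + 2)%Z].

Lemma dihedral_index_ex (i : int) : exists p, exists q, dihedral_index i p q.
Proof.
elim/int_ind: i => [|n [p [q [lf pq /dvdzP[m Dm] /dvdzP[k Dk]]]]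
                    |n [p [q [lf pq /dvdzP[m Dm] /dvdzP[k Dk]]]]].
(* These are F_{-3} and F_{-2}, for the index -5. *)
- by exists 2, (-1); split.
(* 34, 55, 89 are F_9, F_10, F_11: the Fibonacci index moves by 10 when i moves by 1. *)
- exists (34 * p + 55 * q), (55 * p + 89 * q).
  have Dp : p = m * 5 - 2 * q by rewrite -Dm; ring.
  split.
  + have := lf; do 10 move/lucas_fib_next.
    by congr lucas_fib; [lia | ring | ring].
  + by rewrite -pq; ring.
  + by apply/dvdzP; exists (144 * m - 11 * q); rewrite Dp; ring.
  apply/dvdzP; exists (k + (1870 * m ^+ 2 - 286 * (m * q) + 11 * q ^+ 2)).
  by rewrite [RHS]mulrDl -Dk Dp; ring.
exists (89 * p - 55 * q), (34 * q - 55 * p).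
have Dp : p = m * 5 - 2 * q by rewrite -Dm; ring.
split.
+ have := lf; do 10 move/lucas_fib_prev.
  by congr lucas_fib; [lia | ring | ring].
+ by rewrite -pq; ring.
+ by apply/dvdzP; exists (11 * q - 21 * m); rewrite Dp; ring.
apply/dvdzP; exists (k + (5126 * (m * q) - 4895 * m ^+ 2 - 1342 * q ^+ 2)).
by rewrite [RHS]mulrDl -Dk Dp; ring.
Qed.

Lemma lucas_dihedral (i t : int) : t = 2 * lucas (20 * i - 5) ->
  exists p, exists q, exists j,
  [/\ q ^+ 2 - p * q - p ^+ 2 = -1, t = 10 * (p * q) - 2 & t = -22 + 125 * j].
Proof.
move=> ->; have [p [q [[-> _] pq _ /dvdzP[k Dk]]]] := dihedral_index_ex i.
have e : q ^+ 2 - p ^+ 2 = p * q - 1 by rewrite -pq; ring.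
exists p, q, (2 * k); split=> //; rewrite -addrA e; first by ring.
have -> : p * q = k * 25 - 2 by rewrite -Dk addrK.
ring.
Qed.

(** * Irreducibility *)

(** Generating the field by the roots in [algC] provides the embedding at the same time. *)
Lemma splitting_field_exists (p : {poly rat}) : p != 0 ->
  exists (L : splittingFieldType rat) (iota : {rmorphism L -> algC}), is_splitting_field p L.
Proof.
move=> p0; pose pC : {poly algC} := map_poly ratr p.
have [rs Drs] := closed_field_poly_normal pC.
have [Qs [QsC [s1 Ds1 gen]]] := num_field_exists rs.
have pE : map_poly (in_alg Qs) p %= \prod_(z <- s1) ('X - z%:P).
  rewrite -(eqp_map QsC) -map_poly_comp rmorph_prod /=.
  rewrite (eq_map_poly (g := ratr)) => [|r /=]; last by rewrite alg_num_field fmorph_rat.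
  rewrite -/pC Drs -Ds1 big_map.
  under [X in _ %= X]eq_bigr do rewrite rmorphB /= map_polyX map_polyC.
  by rewrite eqp_scale // lead_coef_eq0 map_poly_eq0.
have ax : SplittingField.axiom Qs.
  exists (map_poly (in_alg Qs) p); last by exists s1.
  by apply/polyOver1P; exists p.
pose L : splittingFieldType rat := HB.pack Qs (FieldExt_isSplittingField.Build rat Qs ax).
by exists L, QsC; exists s1.
Qed.

Lemma quintic_rational_root (t : int) (r : rat) : root (quintic t) r -> t = 3 \/ t = -22.
Proof.
move=> rr; have [_ mon] := quintic_monic t.
have rC : root (map_poly ratr (quintic t)) (ratr r : algC) by rewrite fmorph_root.
pose qz : {poly int} := 'X^5 + 10%:P * 'X^3 - (5 * t)%:P * 'X^2 - 15%:P * 'X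
  + (- t ^+ 2 + t - 16)%:P.
have qzE : map_poly (ratr : rat -> algC) (quintic t) = map_poly intr qz.
  rewrite map_quintic map_quintic_gen; congr ('X^5 + _ - _%:P * _ - _ + _%:P) => /=.
    exact/esym/intrM.
  by rewrite -[RHS]/((- t ^+ 2 + t - 16)%:~R : algC) intrB intrD mulrNz !expr2 intrM.
have /intrP[n Dn] : (ratr r : algC) \in Num.int.
  apply: Cint_rat_Aint; first exact: Crat_rat.
  apply: (root_monic_Aint rC); first by rewrite map_monic.
  by rewrite qzE; apply/polyOverP => i; rewrite coef_map intr_int.
apply: (@quintic_integer_root n); apply/eqP; rewrite -(intr_eq0 algC).
move: rC; rewrite /root map_quintic horner_quintic Dn /qf => /eqP rC.
by apply/eqP; rewrite -[RHS]rC !(intrB, intrD) !exprS !expr0 !intrM.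
Qed.

Section TwoThree.

Variables (L : splittingFieldType rat) (t : int) (s : L).
Hypotheses (s2 : s ^+ 2 = 5 * (t%:~R ^+ 2 + 16)) (t22 : t != -22).

Let two : 2 != 0 :> L. Proof. by rewrite natf_eq0. Qed.

Let T : L := t%:~R.
Let f : {poly L} := map_poly (in_alg L) (quintic t).

Let T22 : T + 22 != 0.
Proof.
rewrite (_ : _ + _ = (t + 22)%:~R); last by rewrite intrD.
by rewrite intf_eq0 addr_eq0.
Qed.

Let T16 : T ^+ 2 + 16 != 0.
Proof.
rewrite (_ : _ + _ = (t ^+ 2 + 16)%:~R); last by rewrite intrD !expr2 intrM.
by rewrite intf_eq0; have := sqr_ge0 t; move: (t ^+ 2) => u; clear; lia.
Qed.

Let fE : f = 'X^5 + 10%:P * 'X^3 - (5 * T)%:P * 'X^2 - 15%:P * 'X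
    + (- T ^+ 2 + T - 16)%:P.
Proof. exact: map_quintic. Qed.

Let rootf x : root f x -> qf x T = 0.
Proof. by rewrite /root fE horner_quintic => /eqP. Qed.

Let simple_root x w : f = ('X - x%:P) * w -> ~~ root w x.
Proof.
move=> fw; have fx : root f x by rewrite fw rootM root_XsubC eqxx.
have m0 := qm_neq0 (rootf fx) T16 T22.
have five : 5 != 0 :> L by rewrite natf_eq0.
apply: contraNN (mulf_neq0 five m0) => /eqP wx.
rewrite -horner_deriv_quintic -fE fw derivM !hornerE /= subrr mul0r wx addr0.
by rewrite mulr0.
Qed.

(* Over Q(y1, s) the other four roots of f split into two pairs, so if the pair
   containing y2 is {y2, z}, then z lies in Q(y1, y2, s). *)
Lemma quintic_partner (M : {subfield L}) y1 y2 : root f y1 -> root f y2 -> y1 != y2 ->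
    s \in M -> y1 \in M -> y2 \in M ->
  exists z, [/\ z \in M, root f z, z != y1 & z != y2].
Proof.
move=> r1 r2 y12 Ms My1 My2; have m0 := qm_neq0 (rootf r1) T16 T22.
have MN (n : nat) : n%:R \in M by apply: rpred_nat.
have M1 : 1 \in M := MN 1%N.
have MT : T \in M by apply: rpred_int.
have MD u v : u \in M -> v \in M -> u + v \in M by apply: rpredD.
have MM u v : u \in M -> v \in M -> u * v \in M by apply: rpredM.
have MX u n : u \in M -> u ^+ n \in M by apply: rpredX.
have MV u : u \in M -> u^-1 \in M by rewrite rpredV.
have MO u : u \in M -> - u \in M by rewrite rpredN.
have Mm : qm y1 T \in M.
  by rewrite /qm; repeat first [exact: M1 | exact: MN | exact: MT | exact: My1
    | apply MD | apply MO | apply MM | apply MX].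
have Mn : qn y1 T \in M.
  by rewrite /qn; repeat first [exact: M1 | exact: MN | exact: MT | exact: My1
    | apply MD | apply MO | apply MM | apply MX].
have MA s' : s' \in M -> qA y1 T s' \in M.
  move=> Ms'; rewrite /qA; apply MM; last exact: MV.
  by apply MD; [apply MO | apply MM => //; apply MM => //; apply MV].
have pair A C w : A \in M -> f = ('X - y1%:P) * (('X^2 - A%:P * 'X + C%:P) * w) ->
    root ('X^2 - A%:P * 'X + C%:P) y2 -> exists z, [/\ z \in M, root f z, z != y1 & z != y2].
  move=> HA fw ry2; pose z := A - y2.
  have DQ : 'X^2 - A%:P * 'X + C%:P = ('X - y2%:P) * ('X - z%:P).
    have DC : C = y2 * z.
      move: ry2; rewrite /root !(hornerE, hornerXn) /= => /eqP e.
      by apply/eqP; rewrite -subr_eq0 -[X in _ == X]e /z; apply/eqP; ring.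
    by rewrite DC /z polyCM polyCB; ring.
  have f1 : f = ('X - y1%:P) * (('X - y2%:P) * (('X - z%:P) * w)) by rewrite fw DQ; ring.
  have f2 : f = ('X - y2%:P) * (('X - y1%:P) * (('X - z%:P) * w)) by rewrite f1; ring.
  exists z; split.
  - by apply: rpredB.
  - by rewrite f1 !rootM !root_XsubC eqxx !orbT.
  - by apply: contraNneq (simple_root f1) => ->; rewrite !rootM !root_XsubC eqxx orbT.
  - by apply: contraNneq (simple_root f2) => ->; rewrite !rootM !root_XsubC eqxx orbT.
have fact := quintic_factorization two (rootf r1) m0 T22 s2.
rewrite -fE in fact; have r2' := r2.
rewrite fact !rootM root_XsubC eq_sym (negPf y12) /= in r2'.
case/orP: r2'; first exact: (pair _ _ _ (MA _ Ms) fact).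
apply: (pair _ _ ('X^2 - (qA y1 T s)%:P * 'X + (qC y1 T s)%:P)); first exact/MA/MO.
by rewrite fact; ring.
Qed.

Lemma quintic_no_quadratic_factor (u v : {poly rat}) :
    (exists rs : seq L, f = \prod_(r <- rs) ('X - r%:P)) ->
    (forall r : rat, ~~ root (quintic t) r) ->
    quintic t = u * v -> size u = 3%N -> size v = 4%N -> False.
Proof.
move=> [rs frs] noroot uv szu szv.
have irru : irreducible_poly u.
  apply: cubic_irreducible; first by rewrite szu.
  by move=> r; apply: contraNN (noroot r); rewrite uv rootM => ->.
have irrv : irreducible_poly v.
  apply: cubic_irreducible; first by rewrite szv.
  by move=> r; apply: contraNN (noroot r); rewrite uv rootM orbC => ->.
pose uL := map_poly (in_alg L) u; pose vL := map_poly (in_alg L) v.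
have fuv : f = uL * vL by rewrite /f uv rmorphM.
have : uL %| \prod_(r <- rs) ('X - r%:P) by rewrite -frs fuv dvdp_mulr.
case/dvdp_prod_XsubC => m' um.
have := eqp_size um; rewrite size_map_poly szu size_prod_XsubC.
case: (mask m' rs) um => [|y1 [|y2 [|? ?]]] //; rewrite !big_cons big_nil mulr1.
move=> /eqpf_eq[c c0 uE] _.
have ur y : root uL y = (y == y1) || (y == y2).
  by rewrite uE rootZ // rootM !root_XsubC.
have r1 : root f y1 by rewrite fuv rootM ur eqxx.
have r2 : root f y2 by rewrite fuv rootM ur eqxx orbT.
have y12 : y1 != y2.
  have f1 : f = ('X - y1%:P) * (('X - y2%:P) * (c *: vL)).
    by rewrite fuv uE -!mul_polyC; ring.
  by apply: contraNneq (simple_root f1) => ->; rewrite rootM root_XsubC eqxx.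
pose M := <<<<1; y1>>; s>>%AS.
have My1 : y1 \in M by apply/subvP_adjoin/memv_adjoin.
have Ms : s \in M by apply: memv_adjoin.
have My2 : y2 \in M.
  have u2 : uL`_2 = c.
    rewrite uE coefZ coefM !big_ord_recl big_ord0 !coefB !coefX !coefC /=; ring.
  have u1 : uL`_1 = - c * (y1 + y2).
    rewrite uE coefZ coefM !big_ord_recl big_ord0 !coefB !coefX !coefC /=; ring.
  have -> : y2 = - (uL`_1 / uL`_2) - y1 by rewrite u1 u2; field.
  have Mu k : uL`_k \in M.
    by rewrite coef_map; apply: (subvP (sub1v M)); apply: rpredZ; apply: mem1v.
  by apply: rpredB => //; rewrite rpredN; apply: rpredM => //; rewrite rpredV.
have [z [Mz fz z1 z2]] := quintic_partner r1 r2 y12 Ms My1 My2.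
have vz : root vL z by move: fz; rewrite fuv rootM ur (negPf z1) (negPf z2).
have uy1 : root uL y1 by rewrite ur eqxx.
have : (3 %| \dim M)%N.
  have : (<<1; z>> <= M)%VS by apply/FadjoinP; rewrite sub1v.
  by move/field_dimS; rewrite dim_Fadjoin dimv1 muln1 (irreducible_adjoin_degree irrv vz) szv.
rewrite dim_Fadjoin dim_Fadjoin dimv1 muln1 (irreducible_adjoin_degree irru uy1) szu.
rewrite mulnC Gauss_dvdr // => d3.
have : (adjoin_degree <<1; y1>>%AS s <= 2)%N.
  rewrite -ltnS -size_minPoly -[3%N](@size_XnsubC _ 2 (s ^+ 2)) // dvdp_leq //.
    by rewrite -size_poly_gt0 size_XnsubC.
  apply: minPoly_dvdp; last by rewrite /root !(hornerE, hornerXn) subrr.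
  rewrite rpredB ?polyOverXn ?polyOverC // s2.
  by apply: rpredM; rewrite ?rpred_nat // rpredD ?rpredX ?rpred_int ?rpred_nat.
have : (0 < adjoin_degree <<1; y1>>%AS s)%N by [].
by move: d3; case: (adjoin_degree _ s) => [|[|[|n]]].
Qed.

End TwoThree.

Lemma quintic_irreducible (t : int) : t != 3 -> t != -22 -> irreducible_poly (quintic t).
Proof.
move=> t3 t22; have [sz mon] := quintic_monic t.
have noroot (r : rat) : ~~ root (quintic t) r.
  apply/negP => /quintic_rational_root[] tE; first by rewrite tE in t3.
  by rewrite tE in t22.
have lin (u : {poly rat}) : size u = 2%N -> ~~ (u %| quintic t).
  move=> su; apply/negP => du; have [r ur] := poly2_root su.
  by case/dvdpP: du => v Dv; case/negP: (noroot r); rewrite Dv rootM ur orbT.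
have [d dE] : exists d : rat, forall L : fieldExtType rat, d%:A = 5 * (t%:~R ^+ 2 + 16) :> L.
  exists (5 * (t ^+ 2 + 16))%:~R => L; rewrite alg_num_field ratr_int.
  by rewrite -[LHS]/((5 * (t ^+ 2 + 16))%:~R : L) intrM [(_ ^+ 2 + _)%:~R]intrD !expr2 intrM.
(* For arbitrary t the number s need not be rational, so L is the splitting field of f_t (X^2 - d),
   where s is available. *)
pose g : {poly rat} := 'X^2 - d%:P.
have g0 : g != 0 by rewrite -size_poly_gt0 size_XnsubC.
have f0 : quintic t != 0 by rewrite monic_neq0.
have [L [iota [rs frs _]]] := splitting_field_exists (mulf_neq0 f0 g0).
rewrite rmorphM /= in frs.
have [rf fE] : exists rf : seq L, map_poly (in_alg L) (quintic t) = \prod_(r <- rf) ('X - r%:P).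
  have : map_poly (in_alg L) (quintic t) %| \prod_(r <- rs) ('X - r%:P).
    by rewrite -(eqp_dvdr _ frs) dvdp_mulr.
  case/dvdp_prod_XsubC => m' fm; exists (mask m' rs); apply/eqP.
  by rewrite -eqp_monic ?monic_prod_XsubC // map_monic.
have [s s2] : exists s : L, s ^+ 2 = 5 * (t%:~R ^+ 2 + 16).
  have : map_poly (in_alg L) g %| \prod_(r <- rs) ('X - r%:P).
    by rewrite -(eqp_dvdr _ frs) dvdp_mull.
  case/dvdp_prod_XsubC => m' gm; have := eqp_size gm.
  rewrite size_map_poly size_XnsubC // size_prod_XsubC.
  case: (mask m' rs) gm => [|s ss] // gm _; exists s.
  have gs : root (map_poly (in_alg L) g) s.
    by rewrite (eqp_root gm) root_prod_XsubC mem_head.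
  rewrite -dE; move: gs; rewrite /g rmorphB /= map_polyXn map_polyC /root.
  by rewrite !(hornerE, hornerXn) subr_eq0 => /eqP.
have no23 u v : quintic t = u * v -> size u = 3%N -> size v = 4%N -> False.
  by apply: (quintic_no_quadratic_factor s2 t22 _ noroot); exists rf.
split; first by rewrite sz.
move=> u u1 /dvdpP[v fuv].
have [u0 v0] : u != 0 /\ v != 0.
  by move: f0; rewrite fuv mulf_eq0 negb_or => /andP[].
have du : u %| quintic t by rewrite fuv dvdp_mull.
have dv : v %| quintic t by rewrite fuv dvdp_mulr.
have := size_mul v0 u0; rewrite -fuv sz => szuv.
have su0 : size u != 0%N by rewrite size_poly_eq0.
have sv0 : size v != 0%N by rewrite size_poly_eq0.
have su2 : size u != 2%N by apply: contraTneq du => /lin.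
have sv2 : size v != 2%N by apply: contraTneq dv => /lin.
have [su6 | [[su sv] | [su sv]]] : size u = 6%N \/ (size u = 3%N /\ size v = 4%N)
    \/ (size u = 4%N /\ size v = 3%N).
- by move: (size u) (size v) u1 su0 sv0 su2 sv2 szuv; clear; lia.
- by rewrite -dvdp_size_eqp // su6 sz.
- by case: (no23 u v) => //; rewrite mulrC.
- by case: (no23 v u).
Qed.

(** * An infinite family *)

Fixpoint fib (n : nat) : nat :=
  if n is n1.+1 then if n1 is n2.+1 then (fib n1 + fib n2)%N else 1%N else 0%N.

Lemma fibSS n : fib n.+2 = (fib n.+1 + fib n)%N.
Proof. by []. Qed.

Lemma fib_add m n : fib (m + n).+1 = (fib m.+1 * fib n.+1 + fib m * fib n)%N.
Proof.
suff [] : fib (m + n).+1 = (fib m.+1 * fib n.+1 + fib m * fib n)%N /\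
  fib (m + n).+2 = (fib m.+2 * fib n.+1 + fib m.+1 * fib n)%N by [].
elim: m => [|m [IH1 IH2]]; first by rewrite add0n /= mul1n mul0n !addn0 mul1n.
split; first exact: IH2.
by rewrite addSn fibSS IH1 IH2 (fibSS m.+1) (fibSS m); ring.
Qed.

Lemma coprime_fibS n : coprime (fib n) (fib n.+1).
Proof.
elim: n => // n IHn.
by rewrite /coprime fibSS gcdnDl gcdnC.
Qed.

Lemma gcdn_fib_add m n : gcdn (fib m) (fib (m + n)) = gcdn (fib m) (fib n).
Proof.
case: m => [|m]; first by rewrite add0n.
by rewrite addSn fib_add [(fib m.+1 * _)%N]mulnC gcdnMDl Gauss_gcdr // coprime_sym coprime_fibS.
Qed.

Lemma gcdn_fib m n : gcdn (fib m) (fib n) = fib (gcdn m n).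
Proof.
have [k] := ubnP (m + n); elim: k => // k IHk in m n *; rewrite ltnS => lek.
wlog lemn : m n lek / (m <= n)%N.
  by case: (leqP m n) => [|/ltnW] le; [|rewrite gcdnC [gcdn m n]gcdnC addnC in lek *]; apply.
have [-> | m0] := posnP m; first by rewrite !gcd0n.
by rewrite -(subnKC lemn) gcdn_fib_add gcdnDl IHk; [|lia].
Qed.

Lemma dvdn_fib m n : (m %| n)%N -> (fib m %| fib n)%N.
Proof. by move=> /gcdn_idPl mn; apply/gcdn_idPl; rewrite gcdn_fib mn. Qed.

Lemma fib_mod3 n k : fib (8 * k + n) = fib n %[mod 3].
Proof.
elim: k => [|k IHk]; first by rewrite muln0.
rewrite mulnS -addnA -[X in _ = X]IHk; move: (8 * k + n)%N => m.
rewrite (fib_add 7 m) (_ : fib 8 = 7 * 3)%N // (_ : fib 7 = 4 * 3 + 1)%N //.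
by rewrite mulnAC modnMDl mulnDl mulnAC modnMDl mul1n.
Qed.

Lemma lucas_natE (n : nat) : lucas n.+1 = ((fib n).*2 + fib n.+1)%N.
Proof.
suff [] : lucas n.+1 = ((fib n).*2 + fib n.+1)%N /\ lucas n.+2 = ((fib n.+1).*2 + fib n.+2)%N by [].
elim: n => [|n [IH1 IH2]]; first by split.
split=> //; rewrite lucas_rec (_ : n.+3%:Z - 1 = n.+2); last by lia.
rewrite (_ : n.+3%:Z - 2 = n.+1); last by lia.
by rewrite IH1 IH2 !fibSS; lia.
Qed.

Lemma cassini n : (fib n.+1)%:Z ^+ 2 - (fib n.+1)%:Z * (fib n)%:Z - (fib n)%:Z ^+ 2 = (-1) ^+ n.
Proof.
elim: n => [|n IHn] //; rewrite [RHS]exprS -IHn fibSS PoszD; ring.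
Qed.

Lemma lucas_sqr (n : nat) : odd n -> (lucas n) ^+ 2 + 4 = 5 * (fib n)%:Z ^+ 2.
Proof.
case: n => // n; rewrite oddS lucas_natE => en; have := cassini n.
rewrite -signr_odd (negPf en) expr0 => c.
rewrite PoszD -mul2n PoszM; apply/eqP; rewrite -subr_eq0; apply/eqP.
transitivity (4 * (1 - ((fib n.+1)%:Z ^+ 2 - (fib n.+1)%:Z * (fib n)%:Z - (fib n)%:Z ^+ 2))).
  by ring.
by rewrite c subrr mulr0.
Qed.

Lemma coprime_mul_sqr (a b k : nat) : coprime a b -> (a * b = k ^ 2)%N -> exists g, a = (g ^ 2)%N.
Proof.
move=> cop abk; have [a0 | a_gt0] := posnP a; first by exists 0%N.
pose g := gcdn a k; have g_gt0 : (0 < g)%N by rewrite gcdn_gt0 a_gt0.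
have Da : (a = a %/ g * g)%N by rewrite divnK ?dvdn_gcdl.
have Dk : (k = k %/ g * g)%N by rewrite divnK ?dvdn_gcdr.
have cak : coprime (a %/ g) (k %/ g).
  by rewrite /coprime -(eqn_pmul2r g_gt0) muln_gcdl -Da -Dk mul1n.
have e : (a %/ g * b = g * (k %/ g) ^ 2)%N.
  apply/eqP; rewrite -(eqn_pmul2r g_gt0) mulnAC -Da abk {1}Dk; apply/eqP; ring.
exists g; rewrite {1}Da; suff -> : (a %/ g = g)%N by rewrite mulnn.
apply/eqP; rewrite eqn_dvd; apply/andP; split.
  have : (a %/ g %| g * (k %/ g) ^ 2)%N by rewrite -e dvdn_mulr.
  by rewrite Gauss_dvdl // coprimeXr.
have : (g %| a %/ g * b)%N by rewrite e dvdn_mulr.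
by rewrite Gauss_dvdl // (coprime_dvdl (dvdn_gcdl a k)).
Qed.

(* base_index k is divisible by all the earlier fib_index and prime to 11. *)
Fixpoint base_index (k : nat) : nat :=
  if k is k'.+1 then (base_index k' * (120 * base_index k' + 11))%N else 1%N.
(** 600 b + 55 = 20 (30 b + 3) - 5 is an admissible Lucas index. It is 7 modulo 8, where Fibonacci
    numbers are 1 modulo 3, whence the residue 2 of the radicand. Modulo any earlier index this one
    is 11. *)
Definition fib_index (k : nat) : nat := (120 * base_index k + 11)%N.

Lemma fib_index_coprime11 k : coprime (fib_index k) 11.
Proof.
suff c : coprime (base_index k) 11.
  by rewrite /fib_index coprime_sym /coprime gcdnDr -/(coprime _ _) coprimeMr [coprime 11 (base_index _)]coprime_sym c.
elim: k => // k IHk /=; rewrite coprimeMl IHk /=.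
by rewrite coprime_sym /coprime gcdnDr -/(coprime _ _) coprimeMr [coprime 11 (base_index _)]coprime_sym IHk.
Qed.

Lemma fib_index_dvd k l : (k < l)%N -> (fib_index k %| base_index l)%N.
Proof.
elim: l => // l IHl; rewrite ltnS leq_eqVlt => /orP[/eqP-> | /IHl kl] /=.
  by rewrite dvdn_mull.
by rewrite dvdn_mulr.
Qed.

Lemma fib_index_coprime k l : k != l -> coprime (fib_index k) (fib_index l).
Proof.
wlog kl : k l / (k < l)%N.
  move=> H ne; case: (ltngtP k l) => [kl|/H|e]; first exact: H.
    by rewrite coprime_sym eq_sym; apply.
  by rewrite e eqxx in ne.
move=> _; have /dvdnP[c Dc] := fib_index_dvd kl.
rewrite {2}/fib_index Dc mulnA /coprime gcdnMDl -/(coprime _ _).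
exact: fib_index_coprime11.
Qed.

(** Minus this integer is the square of the nested radical of the k-th parameter; the division is
    exact since F_5 = 5. *)
Definition radicand (k : nat) : nat := (fib (5 * fib_index k) %/ 5)%N.

Lemma radicandE k : (fib (5 * fib_index k) = 5 * radicand k)%N.
Proof.
apply/esym; rewrite /radicand mulnC divnK //.
by have := @dvdn_fib 5 (5 * fib_index k) (dvdn_mulr _ (dvdnn 5)).
Qed.

Lemma radicand_coprime k l : k != l -> coprime (radicand k) (radicand l).
Proof.
move=> /fib_index_coprime /eqP ckl; rewrite /coprime -(eqn_pmul2l (isT : 0 < 5)%N).
by rewrite muln_gcdr -!radicandE gcdn_fib -muln_gcdr ckl.
Qed.

Lemma radicand_mod3 k : (radicand k %% 3 = 2)%N.
Proof.
have : (5 * radicand k = 1 %[mod 3])%N.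
  rewrite -radicandE /fib_index (_ : 5 * _ = 8 * (75 * base_index k + 6) + 7)%N; last by lia.
  by rewrite fib_mod3.
by lia.
Qed.

Lemma radicand_gt0 k : (0 < radicand k)%N.
Proof. by have := radicand_mod3 k; lia. Qed.

Lemma radicand_not_sqr k g : radicand k <> (g ^ 2)%N.
Proof.
move=> e; have := radicand_mod3 k; rewrite e -modnXm.
by case: (g %% 3)%N (ltn_pmod g (isT : 0 < 3)%N) => [|[|[|?]]].
Qed.

(** d e = (r d)^2, and a rational number whose square is an integer is an integer. *)
Lemma rat_sqr_mul (r : rat) (d e : nat) : (0 < d)%N -> r ^+ 2 * d%:R = e%:R ->
  exists k, (d * e = k ^ 2)%N.
Proof.
move=> d0 re; have dn0 := denq_neq0 r.
have e1 : numq r ^+ 2 * d%:Z = denq r ^+ 2 * e%:Z.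
  apply/eqP; rewrite -(eqr_int rat) !expr2 !intrM numqE -!pmulrn -re; apply/eqP; ring.
have /dvdzP[k Dk] : (denq r %| numq r * d%:Z)%Z.
  rewrite -(@dvdz_pexp2r _ _ 2) // exprMn expr2 -[d%:Z ^+ 2]/(d%:Z * d%:Z) mulrA -expr2 e1.
  by rewrite -mulrA dvdz_mulr.
exists `|k|%N; apply/eqP; rewrite -eqz_nat; apply/eqP.
have dn20 : denq r ^+ 2 != 0 by rewrite expf_neq0.
apply: (mulfI dn20); rewrite PoszM mulrCA -e1.
transitivity ((numq r * d%:Z) ^+ 2); first by ring.
rewrite Dk exprMn mulrC; congr (_ * _).
by rewrite -mulnn PoszM abszE -normrM -expr2 ger0_norm ?sqr_ge0.
Qed.

Lemma imaginary_sqr (L : splittingFieldType rat) (iota : {rmorphism L -> algC}) (a : L) (d : nat) :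
  iota a ^+ 2 = - d%:R -> (0 < d)%N -> [/\ a ^+ 2 = - d%:R, a ^+ 2 \in 1%VS & iota a ^+ 2 < 0].
Proof.
move=> ia d0; have a2 : a ^+ 2 = - d%:R.
  by apply: (fmorph_inj iota); rewrite rmorphXn ia rmorphN rmorph_nat.
by rewrite ia a2 oppr_lt0 ltr0n d0 rpredN rpred_nat.
Qed.

(** Write phi(a) = r + r' a' and square. As a' is irrational, 2 r r' = 0. Then r' = 0 gives r^2 = -
    d < 0, and r = 0 gives d = r'^2 d', so that d' d is a square. *)
Lemma not_ext_isomorphic (L L' : splittingFieldType rat)
    (iota : {rmorphism L -> algC}) (iota' : {rmorphism L' -> algC})
    (a : L) (a' : L') (d d' : nat) :
    iota a ^+ 2 = - d%:R -> iota' a' ^+ 2 = - d'%:R -> (0 < d)%N -> (0 < d')%N ->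
    ~ (exists k, (d' * d = k ^ 2)%N) ->
  ~ ext_isomorphic <<1; a>>%AS <<1; a'>>%AS.
Proof.
move=> ia ia' d0 d'0 nsq [phi _ phiK].
have [a2 a2Q a2neg] := imaginary_sqr ia d0.
have [a'2 a'2Q a'2neg] := imaginary_sqr ia' d'0.
pose A : {rmorphism rat -> L'} := in_alg L'.
have [r [r' Dphi]] : exists r, exists r', phi a = A r + A r' * a'.
  have : phi a \in <<1; a'>>%AS by rewrite -phiK; apply: memv_adjoin.
  move=> /(imaginary_decomp a'2Q a'2neg)[u [v [/vlineP[r ->] /vlineP[r' ->] Dphi]]].
  by exists r, r'.
have e : (A r + A r' * a') ^+ 2 = - d%:R by rewrite -Dphi -rmorphXn a2 rmorphN rmorph_nat.
have e1 : A (2 * r * r') * a' = A (- d%:R - r ^+ 2 + r' ^+ 2 * d'%:R).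
  rewrite !(rmorphD, rmorphB, rmorphN, rmorphM, rmorphXn, rmorph_nat) -e.
  by rewrite -[d'%:R]opprK -a'2; ring.
have rr' : 2 * r * r' = 0.
  apply/eqP; apply: contraT => rr'; case/negP: (imaginary_notin1 a'2neg).
  have rr0 : A (2 * r * r') != 0 by rewrite fmorph_eq0.
  have A1 x : A x \in 1%VS by apply: rpredZ; apply: mem1v.
  rewrite -(mulKf rr0 a') e1; rewrite -fmorphV.
  by apply: rpredM; apply: A1.
move/eqP: rr'; rewrite -mulrA mulf_eq0 /= mulf_eq0 => /orP[] /eqP r0; rewrite r0 rmorph0 in e.
  apply: nsq; apply: (@rat_sqr_mul r') => //; apply: (fmorph_inj A).
  rewrite add0r exprMn a'2 in e; rewrite rmorphM rmorphXn !rmorph_nat.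
  by apply: oppr_inj; rewrite -e mulrN.
have : r ^+ 2 = - d%:R.
  apply: (fmorph_inj A); rewrite mul0r addr0 in e.
  by rewrite rmorphN rmorphXn rmorph_nat.
move/eqP; rewrite eq_le => /andP[le _]; have := le_trans (sqr_ge0 r) le.
by rewrite oppr_ge0 lern0 eqn0Ngt d0.
Qed.

Definition family_index (m : nat) : int := 30 * (base_index m)%:Z + 3.
Definition family_param (m : nat) : int := 2 * lucas (20 * family_index m - 5).

Lemma family_indexE m : 20 * family_index m - 5 = (5 * fib_index m)%N.
Proof. by rewrite /family_index /fib_index; lia. Qed.

Lemma family_param_neq m : family_param m != 3 /\ family_param m != -22.
Proof.
rewrite /family_param family_indexE; have : (0 < 5 * fib_index m)%N by rewrite /fib_index; lia.
by case: (5 * _)%N => // n _; rewrite lucas_natE; split; lia.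
Qed.

Lemma nested_radical_family m : nested_radical (family_param m) ^+ 2 = - (radicand m)%:R.
Proof.
rewrite /nested_radical sqrtCK; congr (- _).
have od : odd (5 * fib_index m) by rewrite /fib_index oddM oddD oddM.
have e : family_param m ^+ 2 + 16 = 500 * (radicand m)%:Z ^+ 2.
  rewrite /family_param family_indexE exprMn.
  transitivity (4 * (lucas (5 * fib_index m)%N ^+ 2 + 4)); first by ring.
  by rewrite (lucas_sqr od) radicandE PoszM; ring.
have -> : ((family_param m)%:~R ^+ 2 + 16) / 500 = (radicand m)%:R ^+ 2 :> algC.
  have -> : (family_param m)%:~R ^+ 2 + 16 = 500 * (radicand m)%:R ^+ 2 :> algC.
    transitivity ((family_param m ^+ 2 + 16)%:~R : algC); first by rewrite intrD !expr2 intrM.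
    by rewrite e !expr2 !intrM.
  by field.
by rewrite sqrCK ?ler0n.
Qed.

Theorem theorem5 :
  [/\ (forall (i t : int), t = 2 * lucas (20 * i - 5) ->
        irreducible_poly (quintic t) ->
        forall (L : splittingFieldType rat) (iota : {rmorphism L -> algC}),
          is_splitting_field (quintic t) L ->
          exists a : L, quadratic_unramified_cyclic t iota a),
      (exists s : seq int, forall t : int,
        t \notin s -> irreducible_poly (quintic t))
    & (exists (i : nat -> int) (L : nat -> splittingFieldType rat)
              (iota : forall m, {rmorphism L m -> algC}) (a : forall m, L m),
        let t m := 2 * lucas (20 * i m - 5) in
        (forall m, [/\ irreducible_poly (quintic (t m)),
                       is_splitting_field (quintic (t m)) (L m)
                     & quadratic_unramified_cyclic (t m) (iota m) (a m)])
        /\ (forall m n, m != n ->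
              ~ ext_isomorphic <<1; a m>>%AS <<1; a n>>%AS))].
Proof.
have part1 (i t : int) : t = 2 * lucas (20 * i - 5) -> irreducible_poly (quintic t) ->
    forall (L : splittingFieldType rat) (iota : {rmorphism L -> algC}),
      is_splitting_field (quintic t) L -> exists a : L, quadratic_unramified_cyclic t iota a.
  move=> /lucas_dihedral[p [q [j [pq Dt Dj]]]] irr L iota split.
  exact: (quintic_quadratic_unramified iota pq Dt Dj irr split).
split=> //.
  by exists [:: 3; -22] => t; rewrite !inE negb_or => /andP[]; apply: quintic_irreducible.
(* The types of the embedding and the generator depend on the field, so the three are chosen
   together. *)
pose data : Type := {L : splittingFieldType rat & ({rmorphism L -> algC} * L)%type}.
have ex m : exists S : data, is_splitting_field (quintic (family_param m)) (projT1 S)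
    /\ quadratic_unramified_cyclic (family_param m) (projT2 S).1 (projT2 S).2.
  have [t3 t22] := family_param_neq m; have irr := quintic_irreducible t3 t22.
  have [L [iota split]] := splitting_field_exists (irredp_neq0 irr).
  have [a Ha] := part1 (family_index m) _ erefl irr L iota split.
  by exists (existT _ L (iota, a)).
pose S m := proj1_sig (constructive_indefinite_description _ (ex m)).
have SP m : _ := proj2_sig (constructive_indefinite_description _ (ex m)).
exists family_index, (fun m => projT1 (S m)), (fun m => (projT2 (S m)).1), (fun m => (projT2 (S m)).2).
split=> [m | m n mn].
  have [t3 t22] := family_param_neq m; have [split unr] := SP m.
  by split=> //; apply: quintic_irreducible.
have a2 k : (projT2 (S k)).1 (projT2 (S k)).2 ^+ 2 = - (radicand k)%:R.
  by have [_ [-> _ _]] := SP k; apply: nested_radical_family.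
apply: (not_ext_isomorphic (a2 m) (a2 n)); try exact: radicand_gt0.
move=> [k Dk]; have cop : coprime (radicand n) (radicand m).
  by apply: radicand_coprime; rewrite eq_sym.
by have [g /radicand_not_sqr] := coprime_mul_sqr cop Dk.
Qed.
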